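(* Let $X$ be a finite tree and let $f\colon X\to X$ be a continuous map. Then either every element of $E(X,f)^*$ is continuous, or every element of $E(X,f)^*$ is discontinuous.
   Context: $\mathbb N=\{1,2,3,\dots\}$. A continuum is a (nonempty) compact connected metric space. A dendrite is a locally connected continuum that contains no simple closed curve (no subspace homeomorphic to the unit circle). The order of a point $x$ in a dendrite $X$ is the number of connected components of $X\setminus\{x\}$; $x$ is a branching point if its order is at least $3$. A finite tree is a dendrite having only finitely many branching points, each of finite order. For a compact metric space $X$ and a continuous map $f\colon X\to X$ with iterates $f^n$, the Ellis remainder of $(X,f)$ is $E(X,f)^*=\bigcap_{n=1}^\infty\overline{\{f^k : k\ge n\}}$, where closures are taken in $X^X$ with the product topology (topology of pointwise convergence). Equivalently, $E(X,f)^*=\{f^u: u \text{ a nonprincipal ultrafilter on }\mathbb N\}$, where $f^u(x)=u\text{-}\lim_n f^n(x)$. ''Discontinuous'' means not continuous as a function $X\to X$. *)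

(* Defs.v *)
From HB Require Import structures.
From mathcomp Require Import all_boot all_order all_algebra.
From mathcomp Require Import all_classical all_reals all_analysis.

Set Implicit Arguments.
Unset Strict Implicit.
Unset Printing Implicit Defensive.

Import Order.TTheory GRing.Theory Num.Theory.
Import numFieldNormedType.Exports.

Local Open Scope classical_set_scope.
Local Open Scope card_scope.
Local Open Scope ring_scope.

Definition homeomorphic_sets (S T : topologicalType) (A : set S) (B : set T) :=
  exists (f : S -> T) (g : T -> S),
    [/\ set_bij A B f, forall x, A x -> g (f x) = x,
        {within A, continuous f} & {within B, continuous g}].

Definition unit_circle (R : realType) : set (R * R) :=
  [set z | z.1 ^+ 2 + z.2 ^+ 2 = 1].

Definition locally_connected (T : topologicalType) :=
  forall (x : T) (U : set T), nbhs x U ->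
    exists V, [/\ open V, V x, V `<=` U & connected V].

Definition continuum (R : realType) (X : metricType R) :=
  [/\ [set: X] !=set0, compact [set: X] & connected [set: X]].

Definition dendrite (R : realType) (X : metricType R) :=
  [/\ continuum X, locally_connected X &
      ~ exists A : set X, homeomorphic_sets (@unit_circle R) A].

Definition components (T : topologicalType) (A : set T) : set (set T) :=
  [set connected_component A y | y in A].

(* The order of [x] is the cardinality of [components (~` [set x])]; here
   [`I_3] is the set of natural numbers below 3. *)
Definition branching_point (T : topologicalType) (x : T) :=
  `I_3 #<= components (~` [set x]).

Definition finite_order (T : topologicalType) (x : T) :=
  finite_set (components (~` [set x])).

Definition finite_tree (R : realType) (X : metricType R) :=
  [/\ dendrite X, finite_set [set x : X | branching_point x] &
      forall x : X, branching_point x -> finite_order x].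

Definition ellis_remainder (X : topologicalType) (f : X -> X) : set (X -> X) :=
  \bigcap_(n in [set n : nat | (1 <= n)%N])
    closure ([set iter k f | k in [set k : nat | (n <= k)%N]]
             : set {ptws X -> X}).

(* Main.v *)
(* In a dendrite two points span a unique arc [seg x y], the smallest connected set
   containing them: a point of an arc from x to y missing from some connected set
   containing x and y would give a second arc, hence a simple closed curve. Arcs exist
   in every connected open set, as intersections of nested simple chains of small links.

   Let g in E(X,f)^* be continuous. If two fixed points of f bounded an arc not pointwise
   fixed, there would be fixed points a <> b such that f moves every point strictly between
   them towards b. Points close to a then have orbits that end at, or stay close to, b, while
   g a = a, against continuity of g. The same holds for all iterates, so each Fix(f^k) is
   connected. A root fixed by f turns periodic orbits into antichains of the tree order, and
   antichains have bounded size in a finite tree; so all periodic points are fixed by one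
   h = f^m. Every other point is moved by all iterates of h towards Fix(h), which forces the
   intersection of the sets h^n(X) to be Fix(h) and makes each fixed point of h stable.
   Hence the iterates of h converge to a continuous map, and every element of E(X,f)^* is
   that map followed by some f^r. *)
Require Import Defs.
From HB Require Import structures.
From mathcomp Require Import all_boot all_order all_algebra.
From mathcomp Require Import all_classical all_reals all_analysis.
From mathcomp Require Import zify lra.

Set Implicit Arguments.
Unset Strict Implicit.
Unset Printing Implicit Defensive.

Import Order.TTheory GRing.Theory Num.Theory.
Import numFieldNormedType.Exports.

Local Open Scope classical_set_scope.
Local Open Scope ring_scope.

(** * Compactness: nested closed sets and inverses of injections *)

Lemma compact_directed (T : topologicalType) (I : Type) (F : I -> set T) :
  compact [set: T] -> inhabited I ->
  (forall i j, exists k, F k `<=` F i `&` F j) ->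
  (forall i, closed (F i)) -> (forall i, F i !=set0) ->
  exists x, forall i, F i x.
Proof.
move=> cT [i0] dF clF F0.
have PF : ProperFilter (filter_from [set: I] F).
  apply: filter_from_proper; last by move=> i _; exact: F0.
  apply: filter_from_filter; first by exists i0.
  by move=> i j _ _; have [k Fk] := dF i j; exists k.
have [x [_ xF]] := cT _ PF filterT.
exists x => i; apply: clF => B Bx; apply: xF => //; by exists i.
Qed.

Lemma compact_nested (T : topologicalType) (F : nat -> set T) :
  compact [set: T] -> (forall n, F n.+1 `<=` F n) ->
  (forall n, closed (F n)) -> (forall n, F n !=set0) ->
  exists x, forall n, F n x.
Proof.
move=> cT dF clF F0; apply: compact_directed => //; first exact: (inhabits 0%N).
have mono i k : F (i + k)%N `<=` F i.
  elim: k => [|k IH]; first by rewrite addn0.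
  by rewrite addnS => x /dF /IH.
move=> i j; exists (maxn i j) => x Fx; split.
  by apply: (mono i (maxn i j - i)%N); rewrite subnKC ?leq_maxl.
by apply: (mono j (maxn i j - j)%N); rewrite subnKC ?leq_maxr.
Qed.

(** Suppose that the intersection splits into two separated pieces. Both are closed, and normality
    puts disjoint open sets around them. By compactness some [F n] already lies in the union of
    these open sets and meets both, so it is disconnected. *)
Lemma nested_connected (T : topologicalType) (F : nat -> set T) :
  hausdorff_space T -> compact [set: T] -> (forall n, F n.+1 `<=` F n) ->
  (forall n, closed (F n)) -> (forall n, connected (F n)) ->
  connected (\bigcap_n F n).
Proof.
move=> hT cT dF clF coF; apply: contrapT => /connectedPn [E [E0 EU [s1 s2]]].
have clI : closed (\bigcap_n F n) by apply: closed_bigI => n _; exact: clF.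
have EF b : E b `<=` \bigcap_n F n by rewrite EU; case: b => x Ex; [right|left].
have clE b : closed (E b).
  move=> x cx; have : (\bigcap_n F n) x by apply: clI; apply: closureS cx; exact: EF.
  rewrite EU.
  case: b cx => cx [] // Ex.
    by have : set0 x by rewrite -s2.
  by have : set0 x by rewrite -s1.
have dis : E false `<=` ~` E true.
  move=> x Ef Et; have : set0 x by rewrite -s1; split => //; exact: subset_closure.
  by [].
have nT : normal_space T := compact_normal hT cT.
have nE : set_nbhs (E false) (~` E true).
  rewrite set_nbhsP; exists (~` E true); split => //; exact/closed_openC/clE.
have [B nB clBE] := nT _ (clE false) _ nE.
have [U [oU EO OB]] := (set_nbhsP _ _).1 nB.
have [n Fn] : exists n, F n `<=` U `|` ~` closure B.
  apply: contrapT => /forallNP nF.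
  have [x Fx] : exists x, forall n, ((F n) `&` ((~` U) `&` (closure B))) x.
    apply: compact_nested => // [n x [/dF ? ?]|n|n] //.
      apply: closedI => //; apply: closedI; first exact: open_closedC.
      exact: closed_closure.
    have /existsNP [x /not_implyP [Fx /not_orP [Ox /contrapT Bx]]] := nF n.
    by exists x.
  have : (\bigcap_n F n) x by move=> n _; have [] := Fx n.
  rewrite EU => -[Ex|Ex]; have [_ [Ox Bx]] := Fx 0%N; first exact: Ox (EO _ Ex).
  exact: clBE Bx Ex.
have sep : separated U (~` closure B).
  split; apply/seteqP; split => // x [].
    by move=> cO nBx; apply: nBx; apply: closureS cO.
  move=> Ox cB; have [z [zB Oz]] := cB U (open_nbhs_nbhs (conj oU Ox)).
  by apply: zB; apply: subset_closure; exact: OB.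
have [x Ex] := E0 false; have [y Ey] := E0 true.
have Fx b z : E b z -> F n z by move=> /EF; apply.
case: (connected_subset sep Fn (coF n)) => FO.
  have Oy := FO _ (Fx _ _ Ey); apply: (clBE y) => //.
  by apply: subset_closure; exact: OB.
have := FO _ (Fx _ _ Ex); apply; apply: subset_closure; apply: OB.
exact: EO.
Qed.

(** The preimage of a closed [C] under [G] is the image under [F] of the compact set of points of
    [K] in [C], hence closed. *)
Lemma continuous_inverse_compact (S T : topologicalType) (K : set S)
    (F : S -> T) (G : T -> S) :
  hausdorff_space T -> compact K -> {within K, continuous F} ->
  (forall x, K x -> G (F x) = x) -> {within F @` K, continuous G}.
Proof.
move=> hT cK cF GF; apply/continuous_closedP => C clC.
have cC : compact (K `&` C) by exact: compact_closedI.
apply/closed_subspaceP; exists (F @` (K `&` C)).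
  apply: compact_closed => //; apply: continuous_compact => //.
  by apply: continuous_subspaceW cF => x [].
apply/seteqP; split => y [].
  move=> [x [Kx Cx] <-] FK; split => //.
  by have : C (G (F x)) by rewrite GF.
move=> CG [x Kx xy]; split; last by exists x.
exists x => //; split => //; have : C (G y) by [].
by rewrite -xy GF.
Qed.

(** * Arcs in locally connected compact metric spaces *)

Section SimpleChains.
Context (R : realType) (X : metricType R).
Hypothesis lcX : locally_connected X.

Definition small (e : R) (D : set X) := forall x y, D x -> D y -> mdist x y < e.

(** The closure condition puts closed links of one level inside links of the previous level, which
    makes the limit of nested chains closed. *)
Definition link (e : R) (C D : set X) :=
  [/\ open D, connected D, small e D & closure D `<=` C].

Lemma link_ex e C x : 0 < e -> open C -> C x -> exists2 D, link e C D & D x.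
Proof.
move=> e0 oC Cx.
have e20 : 0 < e / 2 by rewrite divr_gt0.
have nC : nbhs x (C `&` ball x (e / 2)).
  by apply: filterI; [exact: open_nbhs_nbhs|exact: nbhsx_ballx].
have [B nB clB] := @uniform_regular X x _ nC.
have [V [oV Vx VB cV]] := lcX nB.
exists V => //; split => //.
  move=> y z /VB /subset_closure /clB [_ +] /VB /subset_closure /clB [_].
  rewrite ballEmdist /= => xy xz.
  have := metric_triangle y x z; rewrite (metric_sym y x); lra.
by move=> y cy; have [] := clB y (closureS VB cy).
Qed.

(** [s j] names the coarse link that contains [D j]. That [s] never decreases is what later
    transfers the order of links from fine levels to coarse ones. *)
Definition chain e n (C : nat -> set X) a m (D : nat -> set X) (s : nat -> nat) p :=
  [/\ D 0%N a, D m p,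
   forall j, (j <= m)%N -> (s j <= n)%N /\ link e (C (s j)) (D j) &
   forall j, (j < m)%N -> (s j <= s j.+1)%N /\ D j `&` D j.+1 !=set0].

Lemma chain_rcons e n C a m D s q i D' p :
  chain e n C a m D s q -> D m `&` D' !=set0 -> link e (C i) D' ->
  (s m <= i <= n)%N -> D' p ->
  exists m' D'' s', chain e n C a m' D'' s' p /\ s' m' = i.
Proof.
move=> [Da Dq lD cD] DD' lD' /andP[si iN] D'p.
exists m.+1, (fun j => if (j <= m)%N then D j else D').
exists (fun j => if (j <= m)%N then s j else i).
split; last by rewrite ltnn.
split => //=.
- by rewrite ltnn.
- by move=> j jm; case: ifP => [/lD//|].
- move=> j; rewrite ltnS => jm; rewrite jm; case: ifP => [/cD//|jm'].
  by have -> : j = m by lia.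
Qed.

(** The links strictly between [i] and [j], which are [d] in number, are cut out; [s] stays
    nondecreasing. *)
Lemma chain_skip e n C a m D s p i j :
  chain e n C a m D s p -> (i + 2 <= j <= m)%N -> D i `&` D j !=set0 ->
  exists m' D' s', (m' < m)%N /\ chain e n C a m' D' s' p.
Proof.
move=> [Da Dp lD cD] /andP[ij jm] Dij; pose d := (j - i - 1)%N.
have smono k l : (k <= l <= m)%N -> (s k <= s l)%N.
  elim: l => [|l IH]; first by rewrite leqn0 => /andP[/eqP ->].
  move=> /andP[kl lm]; move: kl; rewrite leq_eqVlt => /orP[/eqP -> //|kl].
  by apply: leq_trans (IH _) (cD l lm).1; lia.
exists (m - d)%N, (fun k => D (if (k <= i)%N then k else (k + d)%N)),
  (fun k => s (if (k <= i)%N then k else (k + d)%N)); split; first lia.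
split => //.
- have -> : (m - d <= i)%N = false by lia.
  by have -> : (m - d + d = m)%N by lia.
- by move=> k km; apply: lD; case: ifP; lia.
- move=> k km; case: ifP => ki; last first.
    have -> : (k.+1 <= i)%N = false by lia.
    by rewrite addSn; apply: cD; lia.
  case: ifP => ki'; first by apply: cD; lia.
  have -> : k = i by lia.
  have -> : (i.+1 + d = j)%N by lia.
  by split => //; apply: smono; lia.
Qed.

Definition simple_chain (a b : X) n (C : nat -> set X) :=
  [/\ forall i, (i <= n)%N -> open (C i) /\ connected (C i),
      forall i, (i < n)%N -> C i `&` C i.+1 !=set0,
      C 0%N a, C n b &
      forall i j, (i + 2 <= j <= n)%N -> ~ (C i `&` C j !=set0)].

(** The part of [C] in [S] is open and closed in [C]: a link around a point of [C] that meets [S]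
    lies in [S]. *)
Lemma connected_link_sub e (C S : set X) : 0 < e -> open C -> connected C ->
  C `&` S !=set0 -> (forall D, link e C D -> D `&` S !=set0 -> D `<=` S) ->
  C `<=` S.
Proof.
move=> e0 oC cC CS linkS; suff <- : C `&` S = C by move=> x [].
apply: cC => //.
  exists (C `&` S); last by rewrite setIA setIid.
  rewrite openE => x [Cx Sx]; have [D lD Dx] := link_ex e0 oC Cx.
  have [oD _ _ clD] := lD.
  apply: filterS (open_nbhs_nbhs (conj oD Dx)) => y Dy.
  split; first by apply: clD; exact: subset_closure.
  by apply: linkS lD _ _ Dy; exists x.
exists (closure (C `&` S)); first exact: closed_closure.
apply/seteqP; split => [x CSx|x [Cx clx]].
  by split; [case: CSx|exact: subset_closure].
have [D lD Dx] := link_ex e0 oC Cx; have [oD _ _ _] := lD.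
have [y [[_ Sy] Dy]] := clx D (open_nbhs_nbhs (conj oD Dx)).
by split => //; apply: linkS lD _ _ Dx; exists y.
Qed.

(** Induction on [i]: the set [S i] of end points of chains finishing in [C i] absorbs every link of
    [C i] that it meets, so it fills the connected set [C i]. It starts at [a], or at a point common
    to [C i] and the link before. *)
Lemma chain_reach e a b n C : 0 < e -> simple_chain a b n C ->
  forall i p, (i <= n)%N -> C i p ->
  exists m D s, chain e n C a m D s p /\ s m = i.
Proof.
move=> e0 [ocC meetC Ca _ _].
pose S i := [set p | exists m D s, chain e n C a m D s p /\ s m = i].
suff H : forall i, (i <= n)%N -> C i `<=` S i by move=> i p /H; apply.
have linkS i D' : (i <= n)%N -> link e (C i) D' -> D' `&` S i !=set0 -> D' `<=` S i.
  move=> iN lD' [q [D'q [m [D [s [chD sm]]]]]] p D'p; have [_ Dq _ _] := chD.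
  by apply: (chain_rcons chD _ lD' _ D'p); [exists q|rewrite sm leqnn].
elim=> [|i IH] iN; have [oC cC] := ocC _ iN.
  apply: (connected_link_sub e0 oC cC) => [|D]; last exact: linkS.
  have [D lD Da] := link_ex e0 oC Ca.
  exists a; split => //; exists 0%N, (fun=> D), (fun=> 0%N).
  by split; [split; [| |move=> j _|]|].
apply: (connected_link_sub e0 oC cC) => [|D]; last exact: linkS.
have [q [Ciq CSq]] := meetC i iN.
have [m [D [s [chD sm]]]] := IH (ltnW iN) q Ciq.
have [D' lD' D'q] := link_ex e0 oC CSq; have [_ Dq _ _] := chD.
exists q; split => //.
by apply: (chain_rcons chD _ lD' _ D'q); [exists q|rewrite sm leqnSn].
Qed.

(* A refining chain with the fewest links has no shortcut, hence is simple. *)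
Lemma simple_chain_refine e a b n C : 0 < e -> simple_chain a b n C ->
  exists m D s, [/\ simple_chain a b m D,
    forall j, (j <= m)%N -> (s j <= n)%N /\ link e (C (s j)) (D j) &
    forall i j, (i <= j <= m)%N -> (s i <= s j)%N].
Proof.
move=> e0 scC; have [_ _ _ Cb _] := scC.
pose P m := `[< exists D s, chain e n C a m D s b >].
have exP : exists m, P m.
  have [m [D [s [ch _]]]] := chain_reach e0 scC (leqnn n) Cb.
  by exists m; apply/asboolP; exists D, s.
have [m /asboolP [D [s ch]] minm] := ex_minnP exP.
have [Da Db lD cD] := ch; exists m, D, s; split => //.
  split => // [i im|i im|i j ijm Dij].
  - by have [_ []] := lD i im.
  - by have [] := cD i im.
  have [m' [D' [s' [m'm ch']]]] := chain_skip ch ijm Dij.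
  have : (m <= m')%N by apply: minm; apply/asboolP; exists D', s'.
  by rewrite leqNgt m'm.
move=> k l; elim: l => [|l IH]; first by rewrite leqn0 => /andP[/eqP ->].
move=> /andP[kl lm]; move: kl; rewrite leq_eqVlt => /orP[/eqP -> //|kl].
by apply: leq_trans (IH _) (cD l lm).1; lia.
Qed.

End SimpleChains.

(** * Combining countably many functions into one *)

Section WeightedSum.
Context (R : realType) (X : topologicalType) (t : nat -> X -> R).
Hypothesis t01 : forall n x, 0 <= t n x <= 1.

Let S N x := \sum_(i < N) 2^-1 ^+ i * t i x.

(** This is the sum of the series with terms [2^-1 ^+ i * t i x]: the partial sums are nondecreasing
    and within 2 * 2^-N of it. *)
Definition wsum x := sup (range (S^~ x)).

Let h0 i : 0 < (2^-1 : R) ^+ i. Proof. by rewrite exprn_gt0 ?invr_gt0. Qed.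

Let S_incr N K x : (N <= K)%N -> S N x <= S K x.
Proof.
move=> NK; rewrite -(subnKC NK); elim: (K - N)%N => [|k IH]; first by rewrite addn0.
apply: (le_trans IH); rewrite addnS /S big_ord_recr /= lerDl.
have /andP[t0 _] := t01 (N + k) x.
by rewrite mulr_ge0 // ltW.
Qed.

Let S_tail N K x : (N <= K)%N ->
  S K x + 2 * 2^-1 ^+ K <= S N x + 2 * 2^-1 ^+ N.
Proof.
move=> NK; rewrite -(subnKC NK); elim: (K - N)%N => [|k IH]; first by rewrite addn0.
apply: le_trans IH; rewrite addnS /S big_ord_recr /= exprS.
have := h0 (N + k); set p := _ ^+ _ => p0.
have /andP[t0 t1] := t01 (N + k) x.
have : p * t (N + k)%N x <= p by rewrite ler_piMr // ltW.
lra.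
Qed.

Let S_ub N x : ubound (range (S^~ x)) (S N x + 2 * 2^-1 ^+ N).
Proof.
move=> _ [K _ <-]; have [NK|KN] := leqP N K.
  by apply: le_trans (S_tail x NK); rewrite lerDl mulr_ge0 ?ltW.
apply: (le_trans (S_incr x (ltnW KN))).
by rewrite lerDl mulr_ge0 ?ltW.
Qed.

Let S_sup x : has_sup (range (S^~ x)).
Proof. by split; [exists (S 0%N x), 0%N|exists (S 0%N x + 2 * 2^-1 ^+ 0); exact: S_ub]. Qed.

Let wsum_bounds N x : S N x <= wsum x <= S N x + 2 * 2^-1 ^+ N.
Proof.
apply/andP; split.
  by apply: sup_upper_bound; [exact: S_sup|exists N].
by apply: ge_sup; [exists (S 0%N x), 0%N|exact: S_ub].
Qed.

Lemma wsum_le x y : (forall n, t n x <= t n y) -> wsum x <= wsum y.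
Proof.
move=> le; apply: ge_sup; first by exists (S 0%N x), 0%N.
move=> _ [N _ <-]; apply: le_trans (andP (wsum_bounds N y)).1.
by apply: ler_sum => i _; rewrite ler_wpM2l // ltW.
Qed.

Lemma wsum_lt n x y : (forall n, t n x <= t n y) -> t n x < t n y ->
  wsum x < wsum y.
Proof.
(* [c] is what the [n]-th terms alone contribute to the difference. *)
move=> le lt; pose c := 2^-1 ^+ n * (t n y - t n x).
have c0 : 0 < c by rewrite mulr_gt0 // subr_gt0.
suff : wsum x <= wsum y - c by lra.
apply: ge_sup; first by exists (S 0%N x), 0%N.
move=> _ [N _ <-]; apply: (le_trans (S_incr x (leq_maxl N n.+1))).
set K := maxn _ _; rewrite lerBrDr.
apply: le_trans (andP (wsum_bounds K y)).1.
have nK : (n < K)%N by rewrite /K leq_max leqnn orbT.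
rewrite /S (bigD1 (Ordinal nK)) //= [leRHS](bigD1 (Ordinal nK)) //=.
have : \sum_(i < K | i != Ordinal nK) 2^-1 ^+ i * t i x <=
  \sum_(i < K | i != Ordinal nK) 2^-1 ^+ i * t i y.
  by apply: ler_sum => i _; rewrite ler_wpM2l // ltW.
rewrite /c; set p := _ ^+ n; nra.
Qed.

(** The partial sums converge uniformly; both the tail and the variation of [S N] are kept below
    e/3. *)
Lemma wsum_continuous (M : set X) :
  (forall n, {within M, continuous (t n)}) -> {within M, continuous wsum}.
Proof.
move=> ct; apply/subspace_continuousP => x Mx; apply/cvgrPdist_lt => e e0.
have [N Ne] : exists N, 2 * (2^-1 : R) ^+ N < e / 3.
  have : (fun k => 2 * (2^-1 : R) ^+ k) @ \oo --> 2 * (0 : R).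
    apply: cvgMl_tmp; apply: cvg_expr; rewrite ger0_norm ?invr_ge0 //; lra.
  have e3 : 0 < e / 3 by lra.
  rewrite mulr0 => /cvgrPdist_lt /(_ (e / 3) e3) [].
  move=> N _ /(_ N (leqnn N)); rewrite sub0r normrN ger0_norm; first by exists N.
  by rewrite mulr_ge0 // ltW.
have cS : {within M, continuous (S N)}.
  rewrite /S; elim: N {Ne} => [|N IH].
    rewrite (_ : (fun x => _) = fun=> 0); last by apply/funext => y; rewrite big_ord0.
    by move=> ?; exact: cvg_cst.
  rewrite (_ : (fun x => _) = (fun x => S N x + 2^-1 ^+ N * t N x)); last first.
    by apply/funext => y; rewrite /S big_ord_recr.
  move=> y; apply: cvgD; first exact: IH.
  by apply: cvgMl_tmp; exact: ct.
have /subspace_continuousP /(_ x Mx) /cvgrPdist_lt /(_ (e / 3)) := cS.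
have e3 : 0 < e / 3 by lra.
move=> /(_ e3); apply: filterS => y.
have /andP[? ?] := wsum_bounds N x; have /andP[? ?] := wsum_bounds N y.
rewrite /from_subspace !ltr_norml => /andP[? ?]; apply/andP; split; lra.
Qed.

End WeightedSum.

(** * The limit of nested chains, its linear order and its embedding in the line *)

Section NestedChains.
Context (R : realType) (X : metricType R).
Variables (a b : X) (n : nat -> nat) (C : nat -> nat -> set X) (s : nat -> nat -> nat).
Hypothesis scC : forall k, simple_chain a b (n k) (C k).
Hypothesis linkC : forall k j, (j <= n k.+1)%N ->
  (s k j <= n k)%N /\ link (k.+1%:R^-1 : R) (C k (s k j)) (C k.+1 j).
Hypothesis mono_s : forall k i j, (i <= j <= n k.+1)%N -> (s k i <= s k j)%N.

Let idx k x i := (i <= n k)%N /\ C k i x.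

Definition nested_limit := [set x | forall k, exists i, (i <= n k)%N /\ C k i x].
Local Notation M := nested_limit.

(** A point may lie in two adjacent links, so its index at one level is only known up to one. The
    relation is therefore existential at each level, and the order axioms emerge only from all
    levels together. *)
Definition chain_le x y :=
  forall k, exists i j, [/\ idx k x i, idx k y j & (i <= j)%N].

Let idx_near k x i j : idx k x i -> idx k x j -> (i <= j.+1)%N.
Proof.
move=> [iN Ci] [jN Cj]; rewrite leqNgt; apply/negP => ji.
have [_ _ _ _ sC] := scC k; apply: (sC j i); first by rewrite addn2 ji iN.
by exists x.
Qed.

Let idx_down k x j : idx k.+1 x j -> idx k x (s k j).
Proof.
move=> [jn Cj]; have [sn [_ _ _ cl]] := linkC jn.
by split => //; apply: cl; exact: subset_closure.
Qed.

Let small_C k i : (i <= n k.+1)%N -> small (k.+1%:R^-1 : R) (C k.+1 i).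
Proof. by move=> /linkC[_ []]. Qed.

Let idx_dist k d x y i : idx k.+1 x i -> idx k.+1 y (i + d) ->
  mdist x y < d.+1%:R * (k.+1%:R^-1 : R).
Proof.
elim: d y => [|d IH] y [iN Cx] [jN Cy].
  by rewrite mul1r; apply: (small_C iN) => //; move: Cy; rewrite addn0.
have [_ mC _ _ _] := scC k.+1; rewrite addnS in jN Cy.
have [z [Cz Cz']] := mC (i + d)%N jN.
have := IH z (conj iN Cx) (conj (ltnW jN) Cz).
have := small_C jN Cz' Cy.
have := metric_triangle x z y; rewrite -[in X in _ -> _ -> _ -> X]natr1.
set e := _^-1; lra.
Qed.

Let idx_dist3 k x y i j : idx k.+1 x i -> idx k.+1 y j ->
  (i <= j.+2)%N -> (j <= i.+2)%N -> mdist x y < 3 * (k.+1%:R^-1 : R).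
Proof.
move=> xi yj ij ji.
have H d : (d <= 2)%N -> d.+1%:R * (k.+1%:R^-1 : R) <= 3 * k.+1%:R^-1.
  by move=> d2; rewrite ler_wpM2r ?invr_ge0 // ler_nat.
have [ij'|ij'] := leqP i j.
  apply: lt_le_trans (H (j - i)%N _); last by lia.
  by apply: idx_dist xi _; rewrite subnKC.
rewrite metric_sym; apply: lt_le_trans (H (i - j)%N _); last by lia.
by apply: idx_dist yj _; rewrite subnKC // ltnW.
Qed.

(** Indices at most 2 apart give a distance below 3/(k+1) at level k+1, for all large k. *)
Let close_eq x y K : (forall k, (K <= k)%N -> exists i j,
  [/\ idx k x i, idx k y j, (i <= j.+2)%N & (j <= i.+2)%N]) -> x = y.
Proof.
move=> H; apply/eqP; rewrite -[_ == _]negbK -mdist_gt0; apply/negP.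
set e := mdist x y => e0.
have [m me] : exists m, (m.+1%:R^-1 : R) < e / 3.
  have := near_infty_natSinv_lt (PosNum (divr_gt0 e0 (@ltr0n R 3))).
  by move=> [m _ /(_ m (leqnn m))]; exists m.
have [i [j [xi yj ij ji]]] := H (maxn K m).+1 (leqW (leq_maxl _ _)).
have := idx_dist3 xi yj ij ji; rewrite -/e.
have : ((maxn K m).+1%:R^-1 : R) <= m.+1%:R^-1.
  by rewrite lef_pV2 ?posrE ?ltr0n // ler_nat ltnS leq_maxr.
by move: me; set u := m.+1%:R^-1; set v := (maxn K m).+1%:R^-1; lra.
Qed.

(** Arbitrarily fine levels suffice, because the monotone maps [s] carry the comparison down to
    every coarser level. *)
Let leM_cofinal x y : (forall K, exists k, (K <= k)%N /\
    exists i j, [/\ idx k x i, idx k y j & (i <= j)%N]) -> chain_le x y.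
Proof.
move=> H K; have [k [Kk]] := H K; rewrite -(subnK Kk).
elim: (k - K)%N => [|d IH] // [i [j [xi yj ij]]]; apply: IH.
exists (s (d + K) i), (s (d + K) j); split; [exact: idx_down|exact: idx_down|].
by apply: mono_s; rewrite ij /=; case: yj.
Qed.

Let leM_not x y : ~ chain_le x y -> exists K, forall k i j, (K <= k)%N ->
  idx k x i -> idx k y j -> (j < i)%N.
Proof.
move=> nle; apply: contrapT => /forallNP H; apply: nle; apply: leM_cofinal => K.
have /existsNP [k /existsNP [i /existsNP [j]]] := H K.
move=> /not_implyP [Kk /not_implyP [xi /not_implyP [yj /negP ij]]].
by exists k; split => //; exists i, j; split => //; rewrite leqNgt.
Qed.

Let leM_refl x : M x -> chain_le x x.
Proof. by move=> Mx k; have [i xi] := Mx k; exists i, i. Qed.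

Let leM_total x y : M x -> M y -> chain_le x y \/ chain_le y x.
Proof.
move=> Mx My; have [|/leM_not [K H]] := pselect (chain_le x y); first by left.
right; apply: leM_cofinal => k; exists (maxn K k); split; first exact: leq_maxr.
have [i xi] := Mx (maxn K k); have [j yj] := My (maxn K k).
exists j, i; split => //; apply: ltnW; apply: H xi yj; exact: leq_maxl.
Qed.

Let leM_anti x y : chain_le x y -> chain_le y x -> x = y.
Proof.
move=> xy yx; apply: (@close_eq _ _ 0%N) => k _.
have [i [j [xi yj ij]]] := xy k; have [j' [i' [yj' xi' ij']]] := yx k.
exists i, j; split => //; first lia.
have := idx_near yj yj'; have := idx_near xi' xi; lia.
Qed.

(** If the conclusion failed, the indices of [x] and [z] would stay close at all fine levels,
    forcing [x = z]. *)
Let leM_trans y x z : M x -> M z ->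
  chain_le x y -> chain_le y z -> chain_le x z.
Proof.
move=> Mx Mz xy yz; have [//|/leM_not [K H]] := pselect (chain_le x z).
suff -> : x = z by exact: leM_refl.
apply: (@close_eq _ _ K) => k Kk.
have [i [j [xi yj ij]]] := xy k; have [j' [l [yj' zl jl]]] := yz k.
exists i, l; split => //; have := idx_near yj yj'; have := H k _ _ Kk xi zl; lia.
Qed.

(** A tent of radius 1/(k+1) around a chosen point of the link; it is positive on the whole link,
    whose points are less than 1/(k+1) apart. *)
Let bump k i y : R := if (i <= n k.+1)%N then
  Num.max 0 (k.+1%:R^-1 - mdist (xget a (C k.+1 i)) y) else 0.

Let bump01 k i y : 0 <= bump k i y <= 1.
Proof.
rewrite /bump; case: ifP => _; last by rewrite lexx ler01.
rewrite le_max lexx /= ge_max ler01 /=.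
have : (k.+1%:R^-1 : R) <= 1 by rewrite invf_le1 ?ltr0n // ler1n.
by have := mdist_ge0 (xget a (C k.+1 i)) y; set u := k.+1%:R^-1; lra.
Qed.

Let bump_lip k i x y : bump k i x <= bump k i y + mdist x y.
Proof.
rewrite /bump; case: ifP => _; last by rewrite add0r mdist_ge0.
set c := xget _ _; rewrite ge_max; apply/andP; split.
  by rewrite addr_ge0 ?mdist_ge0 // le_max lexx.
have : (k.+1%:R^-1 : R) - mdist c y <= Num.max 0 (k.+1%:R^-1 - mdist c y).
  by rewrite le_max lexx orbT.
by have := metric_triangle c x y; set u := k.+1%:R^-1; lra.
Qed.

(* The supremum over the predecessors of [x] is continuous and nondecreasing, and a
   bump at [x'] makes it larger at [x'] than at any smaller [x]. *)
Let height k i x := sup [set bump k i y | y in [set y | M y /\ chain_le y x]].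

Let height_ub k i x r : 0 <= r ->
  (forall y, M y -> chain_le y x -> bump k i y <= r) -> height k i x <= r.
Proof.
move=> r0 H; rewrite /height; set A := (X in sup X).
(* The supremum of the empty set is 0 by convention, whence the hypothesis [0 <= r]. *)
have [->|/eqP/set0P ne] := pselect (A = set0).
  by rewrite sup0.
by apply: ge_sup => // _ [y [My yx] <-]; exact: H.
Qed.

Let bump_height k i x y : M y -> chain_le y x -> bump k i y <= height k i x.
Proof.
move=> My yx; apply: sup_upper_bound; last by exists y.
split; first by exists (bump k i y), y.
by exists 1 => _ [z _ <-]; have /andP[] := bump01 k i z.
Qed.

Let height01 k i x : 0 <= height k i x <= 1.
Proof.
apply/andP; split; last first.
  by apply: height_ub => // y _ _; have /andP[] := bump01 k i y.
have [[y [My yx]]|/forallNP H] := pselect (exists y, M y /\ chain_le y x).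
  by apply: le_trans (bump_height k i My yx); have /andP[] := bump01 k i y.
rewrite /height (_ : [set y | _] = set0); first by rewrite image_set0 sup0.
by apply/seteqP; split => // y /H.
Qed.

Let height_le k i x y : M x -> M y -> chain_le x y -> height k i x <= height k i y.
Proof.
move=> Mx My xy; apply: height_ub; first by have /andP[] := height01 k i y.
by move=> z Mz zx; apply: bump_height => //; exact: leM_trans zx xy.
Qed.

(** A predecessor [y] of [x'] that does not precede [x] is squeezed between [x] and [x'], which
    share a link. Hence it is within 3/(m+1) of [x], and bumps are 1-Lipschitz. *)
Let height_near k i m j x x' : M x -> M x' -> idx m.+1 x j -> idx m.+1 x' j ->
  height k i x' <= height k i x + 3 * m.+1%:R^-1.
Proof.
move=> Mx Mx' xj xj'; apply: height_ub.
  have /andP[? _] := height01 k i x; rewrite addr_ge0 // mulr_ge0 //.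
move=> y My yx'; have [yx|xy] := leM_total My Mx.
  by apply: ler_wpDr; [rewrite mulr_ge0|exact: bump_height].
have : bump k i y <= height k i x + mdist y x.
  apply: le_trans (bump_lip k i y x) _.
  by rewrite lerD2r; apply: bump_height => //; exact: leM_refl.
have [i1 [j1 [x1 y1 ij1]]] := xy m.+1; have [j2 [i2 [y2 x2 ij2]]] := yx' m.+1.
have h1 := idx_near xj x1; have h2 := idx_near x2 xj'; have h3 := idx_near y1 y2.
have : mdist y x < 3 * m.+1%:R^-1 by apply: (idx_dist3 y1 xj); lia.
by set u := m.+1%:R^-1; lra.
Qed.

Let height_continuous k i : {within M, continuous (height k i)}.
Proof.
apply/subspace_continuousP => x Mx; apply/cvgrPdist_lt => e e0.
have [m me] : exists m, (m.+1%:R^-1 : R) < e / 3.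
  have := near_infty_natSinv_lt (PosNum (divr_gt0 e0 (@ltr0n R 3))).
  by move=> [m _ /(_ m (leqnn m))]; exists m.
have [j [jN Cj]] := Mx m.+1; have [oC _ _ _ _] := scC m.+1.
have nC : nbhs x (C m.+1 j) by apply: open_nbhs_nbhs; split => //; apply: (oC j jN).1.
rewrite /within /=; near_simpl; apply: filterS nC => y Cy My.
have h1 := height_near k i Mx My (conj jN Cj) (conj jN Cy).
have h2 := height_near k i My Mx (conj jN Cy) (conj jN Cj).
rewrite /from_subspace ltr_norml; move: me h1 h2.
by set u := m.+1%:R^-1 => *; apply/andP; split; lra.
Qed.

Let height_lt x x' : M x -> M x' -> chain_le x x' -> x <> x' ->
  exists k i, height k i x < height k i x'.
Proof.
move=> Mx Mx' xx' nxx'.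
have /leM_not [K HK] : ~ chain_le x' x by move=> x'x; exact: nxx' (leM_anti xx' x'x).
(* Some link around [x'] contains no predecessor of [x]: otherwise such predecessors would bring the
   indices of [x] and [x'] together at all fine levels. *)
have [k1 [i1 [xi1 Hi1]]] : exists k i, idx k x' i /\
    forall y, M y -> chain_le y x -> ~ C k i y.
  apply: contrapT => /forallNP H; apply: nxx'; apply: (@close_eq _ _ K) => k Kk.
  have [i xi] := Mx' k; have /forallNP /(_ i) /not_andP [//|] := H k.
  move=> /existsNP [y /not_implyP [My /not_implyP [yx /contrapT Cy]]].
  have [j [l [yj xl jl]]] := yx k; exists l, i; split => //.
    by have := HK k _ _ Kk xi xl; lia.
  by have := idx_near (conj xi.1 Cy) yj; lia.
have [oC _ _ _ _] := scC k1.
have nC : nbhs x' (C k1 i1).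
  by apply: open_nbhs_nbhs; split; [exact: (oC i1 xi1.1).1|case: xi1].
have /nbhs_ballP [r r0 rC] := nC; have {}r0 : 0 < r by [].
(* With radius below r/2 the bump is supported in the ball of radius [r] at [x'], so it vanishes at
   all predecessors of [x]. *)
have [k ke] : exists m, (m.+1%:R^-1 : R) < r / 2.
  have := near_infty_natSinv_lt (PosNum (divr_gt0 r0 (@ltr0n R 2))).
  by move=> [m _ /(_ m (leqnn m))]; exists m.
have [i [iN Ci]] := Mx' k.+1; exists k, i.
have Cc : C k.+1 i (xget a (C k.+1 i)) by apply: xgetPex; exists x'.
apply: (@le_lt_trans _ _ 0); last first.
  apply: lt_le_trans (bump_height k i Mx' (leM_refl Mx')).
  by rewrite /bump iN lt_max subr_gt0 (small_C iN Cc Ci) orbT.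
apply: height_ub => // y My yx; rewrite /bump iN ge_max lexx /= leNgt; apply/negP => d0.
apply: (Hi1 y My yx); apply: rC; rewrite ballEmdist /=.
have := small_C iN Cc Ci; have := metric_triangle x' (xget a (C k.+1 i)) y.
by rewrite (metric_sym x' (xget _ _)); move: ke d0; set u := k.+1%:R^-1; lra.
Qed.

(** One sequence enumerates all heights; numbers that code no pair repeat the height for (0,0). *)
Let t m x := let p := odflt (0%N, 0%N) (unpickle m) in height p.1 p.2 x.

(** The weighted sum of all heights is strictly increasing for [chain_le], and [a] and [b] are the
    extreme elements of that order. *)
Lemma nested_limit_height : exists F : X -> R,
  [/\ {within M, continuous F},
      forall x y, M x -> M y -> F x = F y -> x = y &
      forall x, M x -> F a <= F x <= F b].
Proof.
have t01 m x : 0 <= t m x <= 1 by exact: height01.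
have t_le x y : M x -> M y -> chain_le x y -> forall m, t m x <= t m y.
  by move=> Mx My xy m; exact: height_le.
have Ma : M a by move=> k; exists 0%N; split => //; have [] := scC k.
have Mb : M b by move=> k; exists (n k); split => //; have [] := scC k.
have lt x y : M x -> M y -> chain_le x y -> x <> y -> wsum t x < wsum t y.
  move=> Mx My xy /(height_lt Mx My xy) [k [i ki]].
  apply: (wsum_lt t01 (n := pickle (k, i))); first exact: t_le.
  by rewrite /t pickleK.
exists (wsum t); split.
- by apply: wsum_continuous => // m; exact: height_continuous.
- move=> x y Mx My xy; apply: contrapT => nxy.
  have [/lt|/lt] := leM_total Mx My; first by move=> /(_ Mx My nxy); rewrite xy ltxx.
  by move=> /(_ My Mx (nesym nxy)); rewrite xy ltxx.
- move=> x Mx; apply/andP; split; apply: wsum_le => //; apply: t_le => // k.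
    have [i xi] := Mx k; exists 0%N, i; split => //; split => //.
    by have [] := scC k.
  have [i xi] := Mx k; exists i, (n k); split => //; last by case: xi.
  by split => //; have [] := scC k.
Qed.

(** Since closed links lie in links of the previous level, the limit is the intersection of the
    finite unions of closed links. Each union is connected because consecutive links meet. *)
Lemma nested_limit_closed_connected : hausdorff_space X -> compact [set: X] ->
  closed M /\ connected M.
Proof.
move=> hX cX; pose F k := \bigcup_(i in [set i | (i <= n k)%N]) closure (C k i).
have ME : M = \bigcap_k F k.
  apply/seteqP; split => [x Mx k _|x Fx k].
    by have [i [iN Ci]] := Mx k; exists i => //; exact: subset_closure.
  have [j /= jN clj] := Fx k.+1 I; have [sN [_ _ _ cl]] := linkC jN.
  by exists (s k j); split => //; exact: cl.
have clF k : closed (F k).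
  apply: closed_bigcup; first exact: (finite_II (n k).+1).
  by move=> i _; exact: closed_closure.
have dF k : F k.+1 `<=` F k.
  move=> x [j /= jN clj]; have [sN [_ _ _ cl]] := linkC jN.
  by exists (s k j) => //; apply: subset_closure; exact: cl.
rewrite ME; split; first by apply: closed_bigI.
apply: nested_connected => // k.
have [oC mC _ _ _] := scC k.
suff H m : (m <= n k)%N -> connected (\bigcup_(i in [set i | (i <= m)%N]) closure (C k i)).
  exact: H.
elim: m => [|m IH] mN.
  rewrite (_ : [set i | _] = [set 0%N]); last first.
    by apply/seteqP; split => i /=; [rewrite leqn0 => /eqP|move=> ->].
  by rewrite bigcup_set1; apply: connected_closure; exact: (oC 0%N mN).2.
rewrite (_ : [set i | _] = [set i | (i <= m)%N] `|` [set m.+1]); last first.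
  apply/seteqP; split => i /=; first by rewrite leq_eqVlt => /orP[/eqP|]; [right|left].
  by move=> [/leqW|->].
rewrite bigcup_setU bigcup_set1; apply: connectedU.
- have [z [Cz Cz']] := mC m mN; exists z; split; last exact: subset_closure.
  by exists m => //=; exact: subset_closure.
- exact: IH (ltnW mN).
- by apply: connected_closure; exact: (oC _ mN).2.
Qed.

End NestedChains.

(** Continuity on the whole line avoids subspace topologies; injectivity concerns only the unit
    interval. *)
Definition arc (R : realType) (X : topologicalType) (g : R -> X) (a b : X) :=
  [/\ continuous g,
      forall s t, 0 <= s <= 1 -> 0 <= t <= 1 -> g s = g t -> s = t,
      g 0 = a & g 1 = b].

Lemma within_continuous_comp_total (S T U : topologicalType) (A : set T)
    (h : S -> T) (g : T -> U) :
  continuous h -> (forall x, A (h x)) -> {within A, continuous g} ->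
  continuous (g \o h).
Proof.
move=> ch Ah /subspace_continuousP cg x W nW.
have H : nbhs (h x) (fun y => A y -> W (g y)) by exact: cg (Ah x) W nW.
have H' : nbhs x (fun y => A (h y) -> W (g (h y))) by exact: ch x _ H.
suff : nbhs x (fun y => W (g (h y))) by [].
by apply: filterS H' => y; apply; exact: Ah.
Qed.

(** Level 0 is the single link [U], which keeps the limit inside [U]; each later level refines the
    preceding one at scale 1/(k+1). *)
Lemma nested_chains_ex (R : realType) (X : metricType R) (U : set X) (a b : X) :
  locally_connected X -> open U -> connected U -> U a -> U b ->
  exists (n : nat -> nat) (C : nat -> nat -> set X) (s : nat -> nat -> nat),
  [/\ forall k, simple_chain a b (n k) (C k),
      forall k j, (j <= n k.+1)%N ->
        (s k j <= n k)%N /\ link (k.+1%:R^-1 : R) (C k (s k j)) (C k.+1 j),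
      forall k i j, (i <= j <= n k.+1)%N -> (s k i <= s k j)%N &
      nested_limit n C `<=` U].
Proof.
move=> lcX oU cU Ua Ub.
pose S := {p : nat * (nat -> set X) | simple_chain a b p.1 p.2}.
have sc0 : simple_chain a b 0 (fun=> U).
  by split => // i j H; exfalso; lia.
pose P k (p q : S) (s : nat -> nat) :=
  (forall j, (j <= (sval q).1)%N -> (s j <= (sval p).1)%N /\
     link (k.+1%:R^-1 : R) ((sval p).2 (s j)) ((sval q).2 j)) /\
  (forall i j, (i <= j <= (sval q).1)%N -> (s i <= s j)%N).
have /choice [next nextP] : forall kp : nat * S, exists q s, P kp.1 kp.2 q s.
  move=> [k [[n C] /= sc]].
  have k0 : (0 : R) < k.+1%:R^-1 by rewrite invr_gt0 ltr0n.
  have [m [D [s [scD lD sD]]]] := simple_chain_refine lcX k0 sc.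
  by exists (exist _ (m, D) scD), s.
pose st := nat_rect (fun=> S) (exist _ (0%N, fun=> U) sc0 : S) (fun k p => next (k, p)).
have /choice [s sP] : forall k, exists s, P k (st k) (st k.+1) s.
  by move=> k; exact: (nextP (k, st k)).
exists (fun k => (sval (st k)).1), (fun k => (sval (st k)).2), s; split.
- by move=> k; exact: (svalP (st k)).
- by move=> k j; apply: (sP k).1.
- by move=> k i j; apply: (sP k).2.
- by move=> x /(_ 0%N) [i []].
Qed.

(** The limit of the chains is compact and connected, so the injection [F] maps it homeomorphically
    onto the interval from [F a] to [F b]. The inverse is the arc. *)
Lemma arc_ex (R : realType) (X : metricType R) (U : set X) (a b : X) :
  compact [set: X] -> locally_connected X -> open U -> connected U ->
  U a -> U b -> a <> b ->
  exists g : R -> X, arc g a b /\ forall t, U (g t).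
Proof.
move=> cX lcX oU cU Ua Ub ab.
have [n [C [s [scC lC sC MU]]]] := nested_chains_ex lcX oU cU Ua Ub.
have hX : hausdorff_space X by exact: metric_hausdorff.
pose M := nested_limit n C.
have [F [cF injF leF]] := nested_limit_height scC lC sC.
have [clM coM] := nested_limit_closed_connected scC lC hX cX.
have Ma : M a by move=> k; exists 0%N; split => //; have [] := scC k.
have Mb : M b by move=> k; exists (n k); split => //; have [] := scC k.
have Fab : F a < F b.
  rewrite lt_neqAle; have /andP[_ ->] := leF a Ma; rewrite andbT.
  by apply/eqP => /(injF _ _ Ma Mb).
have Fitv t : F a <= t <= F b -> (F @` M) t.
  have /connected_intervalP : connected (F @` M).
    by apply: connected_continuous_connected.
  by move=> iF; apply: (iF (F a) (F b)); [exists a|exists b].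
have /choice [G GP] : forall t, exists x, (F @` M) t -> M x /\ F x = t.
  move=> t; have [[x Mx Fx]|nF] := pselect ((F @` M) t); first by exists x.
  by exists a => /nF.
have cM : compact M by apply: (subclosed_compact clM cX).
have cG : {within F @` M, continuous G}.
  apply: (continuous_inverse_compact (@Rhausdorff R) cM cF) => x Mx.
  have [MG FG] := GP (F x) (ex_intro2 _ _ x Mx erefl).
  exact: injF.
(* The parameter is clamped to the unit interval, which makes the path total. *)
pose h t := F a + (F b - F a) * Num.max 0 (Num.min 1 t).
have hitv t : F a <= h t <= F b.
  rewrite /h; set m := Num.max _ _.
  have : 0 <= m <= 1 by rewrite /m le_max lexx /= ge_max ler01 ge_min lexx.
  by move=> /andP[m0 m1]; apply/andP; split; nra.
have hE t : 0 <= t <= 1 -> h t = F a + (F b - F a) * t.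
  move=> /andP[t0 t1]; rewrite /h; congr (_ + _ * _).
  by rewrite min_r // max_r.
exists (G \o h); split; last first.
  by move=> t; apply: MU; exact: (GP _ (Fitv _ (hitv t))).1.
have GE x : M x -> G (F x) = x.
  move=> Mx; have [MG FG] := GP (F x) (ex_intro2 _ _ x Mx erefl).
  exact: injF.
split.
- apply: within_continuous_comp_total cG; last by move=> t; exact: Fitv.
  move=> t; rewrite /h; apply: cvgD; first exact: cvg_cst.
  apply: cvgMl_tmp; apply: continuous_max; first exact: cvg_cst.
  by apply: continuous_min => //; exact: cvg_cst.
- move=> u v u01 v01 /= Guv.
  have [_ hu] := GP _ (Fitv _ (hitv u)); have [_ hv] := GP _ (Fitv _ (hitv v)).
  have : h u = h v by rewrite -hu -hv Guv.
  rewrite !hE // => /addrI; apply: mulfI.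
  by rewrite subr_eq0 gt_eqF.
- by rewrite /= hE ?lexx ?ler01 // mulr0 addr0 GE.
- by rewrite /= hE ?lexx ?ler01 // mulr1 addrC subrK GE.
Qed.

(** * Simple closed curves and segments of dendrites *)

Lemma unit_circle_compact (R : realType) : compact (@unit_circle R).
Proof.
pose I : set R := `[-1, 1]%classic.
apply: (@subclosed_compact (R * R)%type _ (I `*` I)).
- rewrite (_ : @unit_circle R = (fun z : R * R => z.1 ^+ 2 + z.2 ^+ 2) @^-1` [set 1]) //.
  apply: closed_comp; last exact: closed_eq.
  move=> z _; apply: (@cvgD _ (R^o)).
    by apply: (@continuous_comp _ _ _ fst (fun x : R => x ^+ 2));
      [exact: cvg_fst|exact: exprn_continuous].
  by apply: (@continuous_comp _ _ _ snd (fun x : R => x ^+ 2));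
    [exact: cvg_snd|exact: exprn_continuous].
- by apply: compact_setX; exact: segment_compact.
- move=> z /= zc; rewrite /unit_circle /= in zc.
  have := sqr_ge0 z.1; have := sqr_ge0 z.2.
  suff H (x : R) : x ^+ 2 <= 1 -> I x by split; apply: H; lra.
  move=> x1; suff : x \in `[(-1 : R), 1] by [].
  by rewrite in_itv /=; apply/andP; split; nra.
Qed.

(** The upper half circle follows [g] and the lower one [h], both with the parameter [u] obtained
    from the abscissa; the halves agree at the two points where they meet. *)
Lemma two_arcs_circle (R : realType) (X : topologicalType) (g h : R -> X) (a b : X) :
  hausdorff_space X -> arc g a b -> arc h a b ->
  (forall s t, 0 <= s <= 1 -> 0 <= t <= 1 -> g s = h t ->
    s = t /\ (s = 0 \/ s = 1)) ->
  exists A : set X, homeomorphic_sets (@unit_circle R) A.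
Proof.
move=> hX [cg ig g0 g1] [ch ih h0 h1] gh.
pose u (z : R * R) := (1 + z.1) / 2.
have cu : continuous u.
  move=> z; apply: cvgMr_tmp; apply: (@cvgD _ R^o); first exact: cvg_cst.
  exact: cvg_fst.
pose F (z : R * R) := if 0 <= z.2 then g (u z) else h (u z).
have Fp z : 0 <= z.2 -> F z = g (u z) by rewrite /F => ->.
have Fn z : unit_circle z -> z.2 <= 0 -> F z = h (u z).
  rewrite /F /u /unit_circle /= => zc z2; case: ifP => // z2'.
  have z20 : z.2 = 0 by apply/eqP; rewrite eq_le z2.
  have : (z.1 - 1) * (z.1 + 1) = 0 by rewrite z20 in zc; lra.
  move/eqP; rewrite mulf_eq0 => /orP[]/eqP z1.
    by rewrite (_ : z.1 = 1) ?g1; [rewrite (_ : (1 + 1) / 2 = 1) ?g1 ?h1 //; lra|lra].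
  by rewrite (_ : z.1 = -1) ?g0; [rewrite (_ : (1 + -1) / 2 = 0) ?g0 ?h0 //; lra|lra].
have u01 z : unit_circle z -> 0 <= u z <= 1.
  rewrite /u /unit_circle /= => zc; have := sqr_ge0 z.1; have := sqr_ge0 z.2.
  by move=> ? ?; apply/andP; split; nra.
have sq z w : unit_circle z -> unit_circle w -> u z = u w -> z.1 = w.1 /\ z.2 ^+ 2 = w.2 ^+ 2.
  rewrite /u /unit_circle /= => zc wc e; have e1 : z.1 = w.1 by lra.
  by split => //; rewrite e1 in zc; lra.
have mixed z w : unit_circle z -> unit_circle w -> 0 <= z.2 -> w.2 < 0 ->
    g (u z) = h (u w) -> False.
  move=> zc wc z0 w0 /(gh _ _ (u01 _ zc) (u01 _ wc)) [uzw uz].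
  have [z1 z2] := sq _ _ zc wc uzw.
  have : z.2 ^+ 2 = 0.
    by move: uz zc; rewrite /u /unit_circle /= => -[] ?; nra.
  by rewrite z2 => /eqP; rewrite expf_eq0 /= => /eqP; lra.
have injF z w : unit_circle z -> unit_circle w -> F z = F w -> z = w.
  move=> zc wc; rewrite /F; case: ifP => z0; case: ifP => w0 e.
  - have [e1 e2] := sq _ _ zc wc (ig _ _ (u01 _ zc) (u01 _ wc) e).
    apply/eqP; rewrite -pair_eqE /= /pair_eq e1 eqxx /=.
    by rewrite -(@eqrXn2 _ 2) // e2.
  - by exfalso; apply: (mixed z w) => //; rewrite ltNge w0.
  - by exfalso; apply: (mixed w z) => //; rewrite ltNge z0.
  - have [e1 e2] := sq _ _ zc wc (ih _ _ (u01 _ zc) (u01 _ wc) e).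
    move/negbT: z0; move/negbT: w0; rewrite -!ltNge => w0 z0.
    apply/eqP; rewrite -pair_eqE /= /pair_eq e1 eqxx /=.
    by rewrite -eqr_opp -(@eqrXn2 _ 2) // ?oppr_ge0 ?ltW // !sqrrN e2.
have cF : {within @unit_circle R, continuous F}.
  have clc : closed (@unit_circle R).
    apply: compact_closed; last exact: unit_circle_compact.
    exact: norm_hausdorff.
  have c2 : continuous (snd : R * R -> R) by move=> z; exact: cvg_snd.
  have -> : @unit_circle R = (@unit_circle R `&` [set z | 0 <= z.2]) `|`
                             (@unit_circle R `&` [set z | z.2 <= 0]).
    rewrite -setIUr (_ : _ `|` _ = setT) ?setIT //.
    apply/seteqP; split => // z _ /=; have [|/ltW] := leP 0 z.2; by [left|right].
  apply: withinU_continuous.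
  - apply: closedI => //; exact: (closed_comp (fun z _ => c2 z) (@closed_ge _ 0)).
  - apply: closedI => //; exact: (closed_comp (fun z _ => c2 z) (@closed_le _ 0)).
  - apply: (@subspace_eq_continuous _ _ _ (g \o u)).
      by move=> z; rewrite inE => -[_ z0]; apply/esym/Fp.
    by apply: continuous_subspaceT => z; apply: continuous_comp; [exact: cu|exact: cg].
  - apply: (@subspace_eq_continuous _ _ _ (h \o u)).
      by move=> z; rewrite inE => -[zc z0]; apply/esym/Fn.
    by apply: continuous_subspaceT => z; apply: continuous_comp; [exact: cu|exact: ch].
have /choice [G GP] : forall x, exists z, (F @` @unit_circle R) x -> unit_circle z /\ F z = x.
  move=> x; have [[z zc Fz]|nF] := pselect ((F @` @unit_circle R) x); first by exists z.
  by exists (0, 0) => /nF.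
have GF z : unit_circle z -> G (F z) = z.
  by move=> zc; have [Gc] := GP (F z) (ex_intro2 _ _ z zc erefl); exact: injF.
exists (F @` @unit_circle R), F, G; split => //.
- split => //; first by move=> z w; rewrite !inE; exact: injF.
- by apply: continuous_inverse_compact => //; exact: unit_circle_compact.
Qed.

(** [s] may exceed [e]; the piece is then run backwards. *)
Lemma arc_sub (R : realType) (X : topologicalType) (g : R -> X) (a b : X) s e :
  arc g a b -> 0 <= s <= 1 -> 0 <= e <= 1 -> s <> e ->
  arc (fun t => g (s + (e - s) * t)) (g s) (g e).
Proof.
move=> [cg ig _ _] s01 e01 se.
have H t : 0 <= t <= 1 -> 0 <= s + (e - s) * t <= 1.
  by move=> t01; apply/andP; split; nra.
split.
- move=> t; apply: (@continuous_comp _ _ _ (fun t => s + (e - s) * t) g); last exact: cg.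
  by apply: cvgD; [exact: cvg_cst|apply: cvgMl_tmp; exact: cvg_id].
- move=> u v u01 v01 /(ig _ _ (H _ u01) (H _ v01)) /addrI; apply: mulfI.
  by rewrite subr_eq0; apply/eqP => /esym.
- by rewrite mulr0 addr0.
- by rewrite mulr1 addrC subrK.
Qed.

Lemma arc_image_compact (R : realType) (X : topologicalType) (g : R -> X) u v :
  continuous g -> compact (g @` [set t | u <= t <= v]).
Proof.
move=> cg; apply: continuous_compact; first exact: continuous_subspaceT.
rewrite (_ : mkset _ = `[u, v]%classic); first exact: segment_compact.
by apply/seteqP; split => t; rewrite /= in_itv.
Qed.

Lemma arc_image_connected (R : realType) (X : topologicalType) (g : R -> X) u v :
  continuous g -> connected (g @` [set t | u <= t <= v]).
Proof.
move=> cg; apply: connected_continuous_connected; last exact: continuous_subspaceT.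
rewrite (_ : mkset _ = `[u, v]%classic); first exact: segment_connected.
by apply/seteqP; split => t; rewrite /= in_itv.
Qed.

(** Let [s] be the last parameter before [t0] and [e] the first one after it at which [g] is on the
    arc [h]. Between them [g] avoids [h], and the piece of [h] joining the same two points closes
    the curve. *)
Lemma arcs_diverge_circle (R : realType) (X : topologicalType) (g h : R -> X) (a b : X) t0 :
  hausdorff_space X -> arc g a b -> arc h a b -> 0 <= t0 <= 1 ->
  (forall t, 0 <= t <= 1 -> h t <> g t0) ->
  exists A : set X, homeomorphic_sets (@unit_circle R) A.
Proof.
move=> hX ag ah t01 hgt; have [cg ig g0 g1] := ag; have [ch ih h0 h1] := ah.
pose I := h @` [set t | 0 <= t <= 1].
have clI : closed I by apply: compact_closed => //; exact: arc_image_compact.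
have cK u v : compact ([set t | u <= t <= v] `&` g @^-1` I).
  apply: compact_closedI; last exact: (closed_comp (fun t _ => cg t)).
  rewrite (_ : mkset _ = `[u, v]%classic); first exact: segment_compact.
  by apply/seteqP; split => t; rewrite /= in_itv.
have Ia : I (g 0) by exists 0; rewrite /= ?lexx ?ler01 // h0 -g0.
have Ib : I (g 1) by exists 1; rewrite /= ?lexx ?ler01 // h1 g1.
have cid A : {within A, continuous (id : R -> R)}.
  by apply: continuous_subspaceT => t; exact: cvg_id.
have [s] : exists2 c, c \in [set t | 0 <= t <= t0] `&` g @^-1` I &
    forall t, t \in [set t | 0 <= t <= t0] `&` g @^-1` I -> t <= c.
  apply: (compact_EVT_max _ (cK _ _) (cid _)).
  by exists 0; split => //=; lra.
rewrite inE => -[/= s0 [s' s'01 hs]] smax.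
have [e] : exists2 c, c \in [set t | t0 <= t <= 1] `&` g @^-1` I &
    forall t, t \in [set t | t0 <= t <= 1] `&` g @^-1` I -> c <= t.
  apply: (compact_EVT_min _ (cK _ _) (cid _)).
  by exists 1; split => //=; lra.
rewrite inE => -[/= e0 [e' e'01 he]] emin.
rewrite /= in s'01 e'01.
have st : s <> t0 by move=> st; apply: (hgt s' s'01); rewrite hs st.
have et : e <> t0 by move=> et; apply: (hgt e' e'01); rewrite he et.
have {}st : s < t0 by rewrite lt_neqAle; case/andP: s0 => _ ->; rewrite andbT; apply/eqP.
have {}et : t0 < e by rewrite lt_neqAle; case/andP: e0 => -> _; rewrite andbT; apply/eqP => /esym.
have s01 : 0 <= s <= 1 by apply/andP; split; lra.
have e01 : 0 <= e <= 1 by apply/andP; split; lra.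
have se : s <> e by move=> se; move: st et; rewrite se; lra.
have se' : s' <> e'.
  by move=> se'; apply: se; apply: ig => //; rewrite -hs -he se'.
have a1 := arc_sub ag s01 e01 se; have a2 := arc_sub ah s'01 e'01 se'.
rewrite hs he in a2; apply: (two_arcs_circle hX a1 a2) => u v u01 v01 guv.
have w01 : 0 <= s' + (e' - s') * v <= 1 by apply/andP; split; nra.
have Iw : I (g (s + (e - s) * u)) by rewrite guv; exists (s' + (e' - s') * v).
have [wt|/ltW tw] := leP (s + (e - s) * u) t0.
  have : s + (e - s) * u <= s by apply: smax; rewrite inE; split => //=; apply/andP; split; nra.
  move=> us; have u0 : u = 0 by nra.
  move: guv; rewrite u0 mulr0 addr0 -hs => /ih H.
  have : s' = s' + (e' - s') * v by exact: H.
  move=> /eqP; rewrite -subr_eq0 opprD addrA subrr add0r oppr_eq0 mulf_eq0 subr_eq0.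
  by move=> /orP[/eqP/esym//|/eqP ->]; split => //; left.
have : e <= s + (e - s) * u by apply: emin; rewrite inE; split => //=; apply/andP; split; nra.
move=> us; have u0 : u = 1 by nra.
move: guv; rewrite u0 mulr1 addrC subrK -he => /ih H.
have : e' = s' + (e' - s') * v by exact: H.
move=> /eqP; rewrite addrC -subr_eq -[X in X == _]mulr1 -subr_eq0 -mulrBr.
rewrite mulf_eq0 !subr_eq0.
by move=> /orP[/eqP/esym//|/eqP <-]; split => //; right.
Qed.

(* [seg a w z] also reads "z is below w in the tree order rooted at a". *)
Definition seg (T : topologicalType) (x y : T) : set T :=
  [set z | forall C, connected C -> C x -> C y -> C z].

Lemma connected_component_open (T : topologicalType) (A : set T) x :
  locally_connected T -> open A -> open (connected_component A x).
Proof.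
move=> lcT oA; rewrite openE => y Ay.
have Ay' := connected_component_sub Ay.
have [V [oV Vy VA cV]] := lcT y A (open_nbhs_nbhs (conj oA Ay')).
apply: filterS (open_nbhs_nbhs (conj oV Vy)) => z Vz.
by apply: connected_component_trans Ay _; exists V.
Qed.

Section Dendrite.
Context (R : realType) (X : metricType R).
Hypothesis dX : dendrite X.

Let hX : hausdorff_space X. Proof. exact: metric_hausdorff. Qed.
Let cX : compact [set: X]. Proof. by case: dX => -[]. Qed.
Let lcX : locally_connected X. Proof. by case: dX. Qed.

Lemma dendrite_seg_arc (x y : X) : x <> y ->
  exists2 g : R -> X, arc g x y & seg x y = g @` [set t | 0 <= t <= 1].
Proof.
move=> xy; have [g [ag _]] : exists g : R -> X, arc g x y /\ forall t, setT (g t).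
  by apply: arc_ex => //; [exact: openT|case: dX => -[]].
exists g => //; have [cg ig g0 g1] := ag; apply/seteqP; split => [z|_ [t t01 <-] C cC Cx Cy].
  apply; first exact: arc_image_connected.
    by exists 0; rewrite /= ?lexx ?ler01.
  by exists 1; rewrite /= ?lexx ?ler01.
apply: contrapT => nC.
(* A connected set missing [g t] is enlarged to an open component of the complement, where a second
   arc exists. *)
have oW : open (connected_component (~` [set g t]) x).
  apply: connected_component_open => //; apply: closed_openC.
  exact/accessible_closed_set1/hausdorff_accessible.
have CW : C `<=` connected_component (~` [set g t]) x.
  by apply: connected_component_max => // z Cz /= zg; apply: nC; rewrite -zg.
have cW : connected (connected_component (~` [set g t]) x).
  exact: component_connected.
have [h [ah hW]] := arc_ex cX lcX oW cW (CW _ Cx) (CW _ Cy) xy.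
have [_ _] := dX; apply; apply: (arcs_diverge_circle hX ag ah t01) => u _ hu.
by have := connected_component_sub (hW u); rewrite /= hu.
Qed.

Lemma seg_refl (T : topologicalType) (x : T) : seg x x = [set x].
Proof.
apply/seteqP; split => [z|_ -> C //]; apply => //; exact: connected1.
Qed.

Lemma dendrite_seg_connected (x y : X) : connected (seg x y).
Proof.
have [->|xy] := pselect (x = y); first by rewrite seg_refl; exact: connected1.
have [g [cg _ _ _] ->] := dendrite_seg_arc xy; exact: arc_image_connected.
Qed.

Lemma dendrite_seg_closed (x y : X) : closed (seg x y).
Proof.
have [->|xy] := pselect (x = y).
  by rewrite seg_refl; exact/accessible_closed_set1/hausdorff_accessible.
have [g [cg _ _ _] ->] := dendrite_seg_arc xy.
by apply: compact_closed => //; exact: arc_image_compact.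
Qed.

Lemma dendrite_seg_anti (b z w : X) : seg w b z -> seg z b w -> z = w.
Proof.
have [->|wb] := pselect (w = b); first by rewrite seg_refl.
have [g [cg ig g0 g1] ->] := dendrite_seg_arc wb.
move=> [t /= t01 gt] zw.
(* The tail of the arc from [z] to [b] is connected, so it contains [w], the starting point; hence
   the tail is the whole arc. *)
have /zw H : connected (g @` [set u | t <= u <= 1]) by exact: arc_image_connected.
have [||u /= ut gu] := H.
- by exists t => //=; rewrite lexx; case/andP: t01.
- by exists 1 => //=; rewrite lexx andbT; case/andP: t01.
have u0 : u = 0.
  by apply: ig; rewrite ?gu ?g0 ?lexx ?ler01 //; apply/andP; split; lra.
by rewrite -gt -g0; congr g; move: ut; rewrite u0; lra.
Qed.

End Dendrite.

(** * Tree order and iteration *)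

(** Otherwise each residue modulo [m] has a point and a closed set witnessing failure. Finitely many
    witnesses define a neighbourhood of [g], and a late iterate of [f] in it contradicts the witness
    of its own residue. *)
Lemma ellis_iter (X : topologicalType) (f g : X -> X) m :
  (0 < m)%N -> ellis_remainder f g ->
  exists r, forall x (S : set X), closed S ->
    (exists N, forall k, (N <= k)%N -> S (iter (r + k * m) f x)) -> S (g x).
Proof.
move=> m0 Eg; apply: contrapT => /forallNP H.
have /choice [w Hw] : forall r, exists w : X * set X * nat,
    [/\ closed w.1.2, forall k, (w.2 <= k)%N -> w.1.2 (iter (r + k * m) f w.1.1) &
        ~ w.1.2 (g w.1.1)].
  move=> r; have /existsNP [x /existsNP [S /not_implyP [clS /not_implyP [[N SN] nS]]]] := H r.
  by exists (x, S, N).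
pose G : {ptws X -> X} := g.
have near_g : nbhs G [set h | forall r : 'I_m, ~ (w r).1.2 (h (w r).1.1)].
  apply: (@filter_forall _ _ (fun (r : 'I_m) h => ~ (w r).1.2 (h (w r).1.1))
    (nbhs G) (nbhs_filter G)) => r; have [clS _ nS] := Hw r.
  have nC : nbhs (g (w r).1.1) (~` (w r).1.2).
    by apply: open_nbhs_nbhs; split => //; exact: closed_openC.
  exact: (@proj_continuous X (fun=> X) (w r).1.1 g _ nC).
(* An exponent of at least [N.+1 * m] is positive and has a quotient by [m] beyond all the
   thresholds. *)
pose N := (\max_(r < m) (w r).2)%N.
have Nm0 : (0 < N.+1 * m)%N by rewrite muln_gt0.
have [_ [[i /= Ni <-] nSi]] := Eg (N.+1 * m)%N Nm0 _ near_g.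
have im : (i %% m < m)%N by rewrite ltn_mod.
have [_ SN _] := Hw (i %% m)%N; apply: (nSi (Ordinal im)) => /=.
have := SN (i %/ m)%N; rewrite addnC -divn_eq; apply.
have wN : ((w (i %% m)%N).2 <= N)%N.
  exact: (@leq_bigmax _ (fun r : 'I_m => (w r).2) (Ordinal im)).
 apply: leq_trans wN _; apply: leq_trans (leqnSn N) _.
by rewrite leq_divRL.
Qed.

(** * Order and topology of segments *)

Section TreeOrder.
Context (T : topologicalType).
Hypothesis hT : hausdorff_space T.
Hypothesis cT : compact [set: T].
Hypothesis lcT : locally_connected T.
Hypothesis seg_connected : forall x y : T, connected (seg x y).
Hypothesis seg_closed : forall x y : T, closed (seg x y).
Hypothesis seg_anti : forall b z w : T, seg w b z -> seg z b w -> z = w.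

Implicit Types (a b c p q v w x y z : T) (A B C P K U V W : set T).

Lemma closed_point x : closed [set x].
Proof. exact/accessible_closed_set1/hausdorff_accessible. Qed.

Lemma hausdorff_open x y : x <> y ->
  exists A B, [/\ open A, open B, A x, B y & A `&` B = set0].
Proof.
move=> /eqP xy; have := hT; rewrite open_hausdorff => /(_ x y xy).
by move=> [[A B] /= [Ax By] [oA oB AB]]; exists A, B; rewrite !inE in Ax By; split => //; exact/eqP.
Qed.

Lemma segl x y : seg x y x. Proof. by []. Qed.
Lemma segr x y : seg x y y. Proof. by []. Qed.
Hint Resolve segl segr : core.

Lemma segC x y : seg x y = seg y x.
Proof. by apply/seteqP; split=> z H C cC Cx Cy; apply: H. Qed.

Lemma seg_sub C x y : connected C -> C x -> C y -> seg x y `<=` C.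
Proof. by move=> cC Cx Cy z; apply. Qed.

Lemma seg_subseg x y z w : seg x y z -> seg x y w -> seg z w `<=` seg x y.
Proof. by apply: seg_sub. Qed.

Lemma seg_convex P : (forall x y, P x -> P y -> seg x y `<=` P) -> connected P.
Proof.
move=> segP; have [[p Pp]|nP] := pselect (P !=set0); last first.
  rewrite (_ : P = set0); first exact: connected0.
  by apply/seteqP; split => // x Px; apply: nP; exists x.
rewrite (_ : P = \bigcup_(x in P) seg p x).
  by apply: bigcup_connected => //; exists p.
apply/seteqP; split => [x Px|x [y Py pyx]]; first by exists x.
exact: segP pyx.
Qed.

Lemma seg_tri y x z w : seg x z w -> seg x y w \/ seg y z w.
Proof.
move=> H; suff : (seg x y `|` seg y z) w by [].
apply: H; [|by left|by right].
by apply: connectedU => //; exists y.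
Qed.

Lemma seg_antil a z w : seg a w z -> seg a z w -> z = w.
Proof. by rewrite segC (segC a); exact: seg_anti. Qed.

Lemma seg_trans a z w v : seg a w z -> seg a v w -> seg a v z.
Proof. by move=> awz avw; apply: seg_subseg avw _ awz. Qed.

Lemma seg_total a b z w : seg a b z -> seg a b w -> seg a w z \/ seg a z w.
Proof.
move=> abz abw; have [|wbz] := seg_tri w abz; first by left.
have [|zbw] := seg_tri z abw; first by right.
by left; rewrite (seg_anti wbz zbw).
Qed.

Lemma seg_inter x y z w : seg x y z -> seg x z w -> seg z y w -> w = z.
Proof.
move=> xyz xzw zyw; have [xwz|wyz] := seg_tri w xyz.
  by apply: (@seg_antil x).
exact: (seg_anti zyw wyz).
Qed.

Lemma seg_right a b z w : seg a b z -> seg a b w -> seg a w z -> seg z b w.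
Proof.
move=> abz abw awz; have [azw|//] := seg_tri z abw.
by rewrite (seg_antil awz azw).
Qed.

Lemma seg_left a b z w : seg a b z -> seg a b w -> seg z b w -> seg a w z.
Proof. by move=> abz abw zbw; rewrite segC; apply: (@seg_right b); rewrite segC // segC. Qed.

Lemma seg_shift a v z w : seg a v z -> seg z v w -> seg a v w /\ seg a w z.
Proof.
move=> avz zvw; have avw : seg a v w by apply: seg_subseg zvw.
by split => //; exact: seg_left avw zvw.
Qed.

Lemma connected_nbhs x U : nbhs x U -> exists V,
  [/\ nbhs x V, V x, V `<=` U & connected V].
Proof.
move=> /lcT [V [oV Vx VU cV]]; exists V; split => //; exact: open_nbhs_nbhs.
Qed.

Lemma sides_separated x y : x <> y -> exists V W,
  [/\ nbhs x V, nbhs y W, connected V, connected W & V `&` W = set0].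
Proof.
move=> /hausdorff_open [A [B [oA oB Ax By AB]]].
have [V [nV Vx VA cV]] := connected_nbhs (open_nbhs_nbhs (conj oA Ax)).
have [W [nW Wx WB cW]] := connected_nbhs (open_nbhs_nbhs (conj oB By)).
by exists V, W; split => //; rewrite -subset0 -AB; exact: setISS.
Qed.

(** Says that the tree order is closed. Moving [w] to [w'] inside a small connected set changes the
    segment from [a] only within that set, which stays away from [z]. *)
Lemma not_seg_nbhs a z w : ~ seg a w z -> exists A B,
  [/\ nbhs z A, nbhs w B & forall z' w', A z' -> B w' -> ~ seg a w' z'].
Proof.
move=> nz; have zw : z <> w by move=> zw; apply: nz; rewrite zw.
have [V [W [nV nW cV cW VW]]] := sides_separated zw.
exists (V `&` ~` seg a w), W; split => //.
  apply: filterI => //; apply: open_nbhs_nbhs; split => //; exact: closed_openC.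
move=> z' w' [Vz nz'] Ww' /(seg_tri w) [//|ww'z'].
have : set0 z' by rewrite -VW; split => //; apply: seg_sub ww'z' => //; exact: nbhs_singleton nW.
by [].
Qed.

Lemma not_seg_open b z w : ~ seg b w z -> nbhs w [set v | ~ seg b v z].
Proof.
move=> /not_seg_nbhs [A [B [nA nB AB]]]; apply: filterS nB => v Bv.
exact: AB (nbhs_singleton nA) Bv.
Qed.

Lemma seg_above_closed a c : closed [set y | seg a y c].
Proof.
rewrite -[X in closed X]setCK; apply: open_closedC; rewrite openE => y.
exact: not_seg_open.
Qed.

Lemma seg_le_closed (f : T -> T) a : continuous f -> closed [set z | seg a (f z) z].
Proof.
move=> cf; rewrite -[X in closed X]setCK; apply: open_closedC; rewrite openE => z.
move=> /not_seg_nbhs [A [B [nA nB AB]]].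
apply: filterS (filterI nA (cf z _ nB)) => y [Ay By]; exact: AB.
Qed.

(** Otherwise [p] would be isolated in a connected segment. *)
Lemma seg_near p q W : p <> q -> nbhs p W -> exists u, [/\ W u, seg p q u & u <> p].
Proof.
move=> pq; rewrite nbhsE => -[U [oU Up] UW]; apply: contrapT => nu.
have E : seg p q `&` U = [set p].
  apply/seteqP; split => [u [pqu Uu]|_ ->] //.
  by apply: contrapT => up; apply: nu; exists u; split => //; exact: UW.
have : [set p] = seg p q.
  apply: seg_connected; first by exists p.
    by exists U => //; rewrite E.
  exists [set p]; first exact: closed_point.
  by apply/seteqP; split => [_ ->|x []].
move=> /seteqP[_ H]; apply: pq; apply/esym; apply: H; exact: segr.
Qed.

(** The sets of points of [K] on [seg a k], for [k] in [K] on the segment, are nested and compact; a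
    common point is the first point of [K]. *)
Lemma seg_min a b K : closed K -> K `&` seg a b !=set0 ->
  exists2 m, K m /\ seg a b m & forall k, K k -> seg a b k -> seg a k m.
Proof.
move=> clK [k0 [Kk0 abk0]].
pose I := {k | K k /\ seg a b k}.
have [m Hm] : exists m, forall i : I, (K `&` seg a (sval i)) m.
  apply: compact_directed => // [|[i [Ki abi]] [j [Kj abj]]|i|[i [Ki abi]]].
  - exact: inhabits (exist _ k0 (conj Kk0 abk0)).
  - have [ij|ji] := seg_total abi abj.
      exists (exist _ i (conj Ki abi)) => x /= [Kx aix]; split => //; split => //.
      exact: seg_trans aix ij.
    exists (exist _ j (conj Kj abj)) => x /= [Kx aix]; split => //; split => //.
    exact: seg_trans aix ji.
  - by apply: closedI => //; exact: seg_closed.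
  - by exists i.
have [Km akm] := Hm (exist _ k0 (conj Kk0 abk0)).
exists m; first by split => //; exact: seg_trans akm abk0.
by move=> k Kk abk; have [] := Hm (exist _ k (conj Kk abk)).
Qed.

Lemma seg_max a b K : closed K -> K `&` seg a b !=set0 ->
  exists2 m, K m /\ seg a b m & forall k, K k -> seg a b k -> seg a m k.
Proof.
move=> clK [k0 [Kk0 abk0]].
have [|m [Km bam] H] := @seg_min b a K clK; first by exists k0; rewrite segC.
have abm : seg a b m by rewrite segC.
exists m => // k Kk abk; apply: (seg_left abk abm).
by rewrite segC; apply: H => //; rewrite segC.
Qed.

(** The first-point map onto a subtree: every segment from [x] into [P] passes through [q]. *)
Definition proj_point P x q := P q /\ forall r, P r -> seg x r q.

(** Two first points [p] and [p'] coincide: a point of [P] between them and near [p] lies on the way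
    from [x] to one of them, so it equals that one. *)
Lemma proj_point_ex P x : closed P -> connected P -> P !=set0 ->
  exists q, proj_point P x q.
Proof.
move=> clP cP [q0 Pq0].
have first q : P q -> exists p, [/\ P p, seg x q p & forall r, P r -> seg x p r -> r = p].
  move=> Pq; have [|p [Pp xqp] H] := @seg_min x q P clP; first by exists q.
  exists p; split => // r Pr xpr.
  by apply: (seg_antil xpr); apply: H => //; exact: seg_trans xpr xqp.
have [p [Pp xq0p minp]] := first q0 Pq0; exists p; split => // r Pr.
have [p' [Pp' xrp' minp']] := first r Pr; suff -> : p = p' by [].
apply: contrapT => pp'.
have [V [W [nV nW cV cW VW]]] := sides_separated pp'.
have [u [Vu ppu up]] := seg_near pp' nV.
have Pu : P u by apply: seg_sub ppu.
have [pxu|xp'u] := seg_tri x ppu.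
  by apply: up; apply: minp => //; rewrite segC.
have up' := minp' u Pu xp'u.
have : set0 p' by rewrite -VW -up'; split => //; rewrite up'; exact: nbhs_singleton nW.
by [].
Qed.

Lemma median_ex x y z : exists m, [/\ seg x y m, seg x z m & seg y z m].
Proof.
have yz0 : seg y z !=set0 by exists y; exact: segl.
have [m [ym Hm]] := proj_point_ex x (@seg_closed y z) (@seg_connected y z) yz0.
by exists m; split => //; apply: Hm; [exact: segl|exact: segr].
Qed.

Lemma component_not_seg b x y : connected_component (~` [set b]) x y -> ~ seg x y b.
Proof. by move=> [C [Cx Cb cC] Cy] /(_ C cC Cx Cy) /Cb /(_ erefl). Qed.

Lemma three_sides_branching m x y z : m <> x -> m <> y -> m <> z ->
  seg x y m -> seg x z m -> seg y z m -> branching_point m.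
Proof.
move=> mx my mz xym xzm yzm; rewrite /branching_point.
pose comp := connected_component (~` [set m]).
pose e (i : nat) := if i is 0%N then x else if i is 1%N then y else z.
have em i : m <> e i by case: i => [|[|]].
have ce i j : comp (e i) = comp (e j) -> ~ seg (e i) (e j) m.
  move=> E; apply: component_not_seg; rewrite -/comp E.
  by apply: connected_component_refl => /= H; apply: (em j).
apply: (@card_le_trans _ _ _ [set comp (e i) | i in `I_3]); last first.
  by apply: subset_card_le => _ [i _ <-]; exists (e i) => //= H; exact: (em i).
suff /inj_card_eq /card_eqPle [] : {in `I_3 &, injective (comp \o e)} by [].
move=> i j; rewrite !inE /= => i3 j3 /ce.
by case: i i3 => [|[|[|]]] // _; case: j j3 => [|[|[|]]] //= _ H; exfalso;
  apply: H => //; rewrite segC.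
Qed.

(** * Bounded antichains *)

Section Comparable.
Hypothesis finB : finite_set [set x : T | branching_point x].
Hypothesis finO : forall x : T, branching_point x -> finite_order x.

Lemma components_finite x : finite_set (components (~` [set x])).
Proof.
have [/finO //|nb] := pselect (branching_point x).
apply: contrapT => /infiniteP inf; apply: nb; apply: card_le_trans inf.
exact: subset_card_le.
Qed.

(* Points with the same position with respect to [o] and to all branching points
   are comparable for the order rooted at [o]. *)
Lemma comparable_ex o : exists N, forall u : nat -> T, exists i j,
  (i < j <= N)%N /\ (seg o (u j) (u i) \/ seg o (u i) (u j)).
Proof.
have /finite_seqP [bs bsE] : finite_set ([set o] `|` [set x : T | branching_point x]).
  by rewrite finite_setU; split => //; exact: finite_set1.
pose sig x := [seq connected_component (~` [set b]) x | b <- bs].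
have finsig : finite_set (range sig).
  rewrite /sig; elim: bs {bsE sig} => [|b bs IH].
    by apply: (sub_finite_set _ (finite_set1 [::])) => _ [x _ <-].
  (* By convention the component of [b] in its own complement is empty, whence the extra value
     [set0]. *)
  have fb : finite_set (set0 |` components (~` [set b])).
    by rewrite finite_setU; split; [exact: finite_set1|exact: components_finite].
  apply: (sub_finite_set _ (finite_image2 cons fb IH)) => _ [x _ <-] /=.
  exists (connected_component (~` [set b]) x).
    have [->|xb] := pselect (x = b); last by right; exists x.
    by left; apply: connected_component_out => /=; apply.
  by exists [seq connected_component (~` [set b]) x | b <- bs] => //; exists x.
have [n /card_set_bijP [phi [phiI phiinj _]]] := finsig.
exists n => u.
have [i [j [ij jn sij]]] : exists i j, [/\ (i < j)%N, (j <= n)%N & sig (u i) = sig (u j)].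
  apply: contrapT => H.
  have fn (i : 'I_n.+1) : (phi (sig (u i)) < n)%N by apply: phiI; exists (u i).
  have inj : injective (fun i : 'I_n.+1 => Ordinal (fn i)).
    move=> i j [] e; have {}e : sig (u i) = sig (u j).
      by apply: phiinj e; rewrite inE; [exists (u i)|exists (u j)].
    apply/val_inj => /=; have [ij|ji|//] := ltngtP i j; exfalso; apply: H.
      by exists i, j; split => //; rewrite -ltnS.
    by exists j, i; split => //; rewrite -ltnS.
  by have := leq_card _ inj; rewrite !card_ord ltnn.
exists i, j; split; first by rewrite ij.
(* If the median is neither of the two points, it is [o] or a branching point, and it separates
   them, although their signatures agree. *)
have [m [om oj ijm]] := median_ex o (u i) (u j).
have [<-|mi] := pselect (m = u i); first by left.
have [<-|mj] := pselect (m = u j); first by right.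
exfalso; suff bm : m \in bs.
  have : connected_component (~` [set m]) (u i) = connected_component (~` [set m]) (u j).
    have := congr1 (fun s => nth set0 s (index m bs)) sij.
    by rewrite !(nth_map m) ?index_mem // nth_index.
  move=> E; have : connected_component (~` [set m]) (u i) (u j).
    by rewrite E; apply: connected_component_refl => /= /esym.
  by move=> /component_not_seg; apply.
have : ([set o] `|` [set x : T | branching_point x]) m.
  have [->|mo] := pselect (m = o); first by left.
  right; exact: (@three_sides_branching m o (u i) (u j)).
by rewrite bsE.
Qed.

Lemma seg_image (f : T -> T) x y : continuous f ->
  seg (f x) (f y) `<=` f @` seg x y.
Proof.
move=> cf; apply: seg_sub; [|by exists x; [exact: segl|]|by exists y; [exact: segr|]].
by apply: connected_continuous_connected => //; exact: continuous_subspaceT.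
Qed.

(** The points of [F] above a given element of the chain form a closed set; these sets are
    nested. *)
Lemma chain_upper_bound a F A : closed F -> A `<=` F -> A !=set0 ->
  (forall u v, A u -> A v -> seg a v u \/ seg a u v) ->
  exists d, F d /\ forall c, A c -> seg a d c.
Proof.
move=> clF AF [c0 Ac0] chA.
have [d Hd] : exists d, forall i : {c | A c}, (F `&` [set y | seg a y (sval i)]) d.
  apply: compact_directed => // [|[u Au] [v Av]|i|[u Au]].
  - exact: inhabits (exist _ c0 Ac0).
  - have [vu|uv] := chA u v Au Av.
      exists (exist _ v Av) => y /= [Fy avy]; split => //; split => //.
      exact: seg_trans vu avy.
    exists (exist _ u Au) => y /= [Fy auy]; split => //; split => //.
    exact: seg_trans uv auy.
  - by apply: closedI => //; exact: seg_above_closed.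
  - by exists u; split; [exact: AF|exact: segr].
exists d; split; first by have [] := Hd (exist _ c0 Ac0).
by move=> c Ac; have [] := Hd (exist _ c Ac).
Qed.

(** Zorn's lemma on the part of [Q] above [y0], where [y0] bounds the empty chain. *)
Lemma seg_maximal a (Q : set T) y0 : Q y0 ->
  (forall A, A `<=` Q -> A !=set0 ->
     (forall u v, A u -> A v -> seg a v u \/ seg a u v) ->
     exists d, Q d /\ forall c, A c -> seg a d c) ->
  exists m, [/\ Q m, seg a m y0 & forall d, Q d -> seg a d m -> d = m].
Proof.
move=> Qy0 ub; pose S := {y | Q y /\ seg a y y0}.
pose le (u v : S) := `[< seg a (sval v) (sval u) >].
have [||||m mmax] := @Zorn S le.
- by move=> u; apply/asboolP; exact: segr.
- by move=> u v w /asboolP uv /asboolP vw; apply/asboolP; exact: seg_trans uv vw.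
- move=> [u Hu] [v Hv] /asboolP /= uv /asboolP /= vu.
  by apply: eq_exist => /=; exact: seg_antil uv vu.
- move=> A chA; have [[[c0 Hc0] Ac0]|nA] := pselect (A !=set0); last first.
    exists (exist _ y0 (conj Qy0 (@segr a y0))) => s As.
    by exfalso; apply: nA; exists s.
  have [|||d [Qd Hd]] := ub (sval @` A).
  + by move=> _ [[u Hu] _ <-]; case: Hu.
  + by exists c0, (exist _ c0 Hc0).
  + move=> _ _ [u Au <-] [v Av <-]; have [/asboolP|/asboolP] := chA u v Au Av.
      by left.
    by right.
  have ad0 : seg a d y0.
    apply: (seg_trans Hc0.2); apply: Hd; by exists (exist _ c0 Hc0).
  by exists (exist _ d (conj Qd ad0)) => s As; apply/asboolP; apply: Hd; exists s.
exists (sval m); split; [by case: (svalP m)|by case: (svalP m)|].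
move=> d Qd dm; have Sd : Q d /\ seg a d y0.
  by split => //; apply: (seg_trans _ dm); case: (svalP m).
by rewrite -(mmax (exist _ d Sd)) //; exact/asboolP.
Qed.

(** * Fixed points and repelling pairs *)

Section Iteration.
Variable f : T -> T.
Hypothesis cf : continuous f.

(* A maximal [d] such that all of [seg x d] is moved away from [a] must be fixed:
   otherwise a piece of [seg d (f d)] could be added. *)
Lemma flow_fixed a x : seg a (f x) x ->
  exists d, [/\ f d = d, seg a d x & forall z, seg x d z -> seg a (f z) z].
Proof.
move=> ax; pose Q := [set y | seg a y x /\ forall z, seg x y z -> seg a (f z) z].
have Qx : Q x by split; [exact: segr|rewrite seg_refl => z ->].
have [|d [[adx Qd] _ dmax]] := @seg_maximal a Q x Qx.
  move=> A AQ [c0 Ac0] chA.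
  (* The bound [d] is sought in the closure of [J]: points of [J] near [d] reach past any given
     point strictly before [d], and the condition at [d] itself is closed. *)
  pose J := \bigcup_(c in A) seg x c.
  have AJ : A `<=` closure J.
    by move=> c Ac; apply: subset_closure; exists c => //; exact: segr.
  have [d [cld Hd]] := chain_upper_bound (@closed_closure _ J) AJ (ex_intro _ c0 Ac0) chA.
  exists d; split => //; split.
    by apply: (seg_trans _ (Hd c0 Ac0)); case: (AQ c0 Ac0).
  move=> z xdz; have [->|zd] := pselect (z = d).
    have clG := seg_le_closed (a := a) cf.
    apply: clG; apply: closureS cld => y [c Ac xcy].
    by have [_] := AQ c Ac; apply.
  have nd : ~ seg d d z by rewrite seg_refl => /zd.
  have [v [[c Ac xcv] ndv]] := cld _ (not_seg_open nd).
  have [xvz|vdz] := seg_tri v xdz.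
    by have [_] := AQ c Ac; apply; apply: seg_trans xvz xcv.
  by exfalso; apply: ndv; rewrite segC.
exists d; split => //; apply: contrapT => fd.
have add : seg a (f d) d by apply: Qd; exact: segr.
have [V [W [nV nW cV cW VW]]] := sides_separated (nesym fd).
have nW' : nbhs d (V `&` f @^-1` W) by apply: filterI => //; exact: cf.
have [V' [nV' V'd V'sub cV']] := connected_nbhs nW'.
have [d' [V'd' dfd' d'd]] := seg_near (nesym fd) nV'.
apply: d'd; have [afd' ad'd] := seg_shift add dfd'.
apply: dmax => //; split; first exact: seg_trans adx ad'd.
move=> z /(seg_tri d) [/Qd //|dd'z].
have V'z : V' z by apply: seg_sub dd'z.
have [Vz Wfz] := V'sub z V'z.
have afdz : seg a (f d) z by apply: (seg_trans _ afd'); case: (seg_shift ad'd dd'z).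
(* [z] is on the segment from [a] to [f d], but not between [f z] and [f d], which both lie in
   [W]. *)
have [//|fzfdz] := seg_tri (f z) afdz.
have : set0 z; last by [].
rewrite -VW; split => //; apply: seg_sub fzfdz => //.
exact: nbhs_singleton nW.
Qed.

(** For [x = a] the hypothesis of [flow_fixed] is trivial. *)
Lemma fixed_point_ex a : exists o, f o = o.
Proof. by have [d [fd _ _]] := flow_fixed (@segl a (f a)); exists d. Qed.


Lemma fixed_closed : closed [set x | f x = x].
Proof.
rewrite -[X in closed X]setCK; apply: open_closedC; rewrite openE => x /= fx.
have [V [W [nV nW _ _ VW]]] := sides_separated fx.
apply: filterS (filterI nW (cf nV)) => y [Wy Vfy] fy.
have : set0 y by rewrite -VW; split => //; rewrite -fy.
by [].
Qed.

(** Moving towards [b] means that [z] is not between [f z] and [b]; the image may leave the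
    segment. *)
Definition repelling_pair a b := [/\ f a = a, f b = b, a <> b &
  forall z, seg a b z -> z <> a -> z <> b -> ~ seg (f z) b z].

Lemma not_fixed_nbhs z : f z <> z -> exists V' V W,
  [/\ nbhs z V', connected V', connected W, V' `<=` V `&` f @^-1` W & V `&` W = set0] /\
  V z /\ W (f z).
Proof.
move=> /nesym /sides_separated [V [W [nV nW cV cW VW]]].
have nW' : nbhs z (V `&` f @^-1` W) by apply: filterI => //; exact: cf.
have [V' [nV' V'z V'sub cV']] := connected_nbhs nW'.
by exists V', V, W; split => //; split; [exact: nbhs_singleton nV|exact: nbhs_singleton nW].
Qed.

(** The fixed points nearest to [c] on both sides bound a segment without fixed points inside, and
    the direction of motion cannot change there. *)
Lemma repelling_pair_ex a c : f a = a -> f c <> c -> seg a (f c) c ->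
  exists a' b, repelling_pair a' b.
Proof.
move=> fa fc afc; have [d [fd adc Hd]] := flow_fixed afc.
have [|b [fb cdb] bmin] := @seg_min c d _ fixed_closed.
  by exists d; split => //; exact: segr.
have [|a' [fa' caa'] amin] := @seg_min c a _ fixed_closed.
  by exists a; split => //; exact: segr.
have [adb abc] := seg_shift adc cdb.
have aca' : seg a c a' by rewrite segC.
have ca' : c <> a' by move=> ca'; apply: fc; rewrite ca'.
have a'bc : seg a' b c by apply: (seg_right _ abc aca'); exact: seg_trans aca' abc.
have cb : c <> b by move=> cb; apply: fc; rewrite cb.
have upper z : seg c b z -> z <> b -> seg a' (f z) z /\ f z <> z.
  move=> cbz zb; have cdz : seg c d z by exact: seg_trans cbz cdb.
  split; last by move=> fz; apply: zb; apply: (seg_antil cbz); exact: bmin.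
  have [aa'z|//] := seg_tri a' (Hd z cdz).
  have [abz azc] := seg_shift abc cbz.
  have zc : z = c by apply: (seg_antil _ azc); exact: seg_trans aa'z aca'.
  by exfalso; apply: ca'; rewrite zc in aa'z; exact: seg_antil aa'z aca'.
have nfix z : seg a' c z -> z <> a' -> f z <> z.
  move=> a'cz za' fz; apply: za'; apply: (@seg_antil c); first by rewrite segC.
  by apply: amin => //; rewrite segC; have [] := seg_shift aca' a'cz.
have lower z : seg a' c z -> z <> a' -> seg a' (f z) z /\ f z <> z.
  move=> a'cz za'; split; last exact: nfix.
  apply: contrapT => nz.
  have Kc : seg a' (f c) c.
    by have [aa'c|//] := seg_tri a' afc; case: ca'; exact: seg_antil aa'c aca'.
  (* [v] is the first point after [z] that is moved away from [a']. Since [v] is not fixed, points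
     just before it are moved in the same way. *)
  have [|v [Kv zcv] vmin] := seg_min (a := z) (b := c) (seg_le_closed (a := a') cf).
    by exists c; split => //; exact: segr.
  have vz : v <> z by move=> vz; apply: nz; rewrite -vz.
  have [a'cv a'vz] := seg_shift a'cz zcv.
  have va' : v <> a' by move=> va'; rewrite va' in zcv; apply: za'; exact: seg_anti a'cz zcv.
  have [V' [V [W [[nV' cV' cW V'sub VW] [Vv Wv]]]]] := not_fixed_nbhs (nfix _ a'cv va').
  have [u [V'u vzu uv]] := seg_near vz nV'.
  have [Vu Wu] := V'sub u V'u.
  apply: uv; apply: (@seg_antil z); first by rewrite segC.
  have zvu : seg z v u by rewrite segC.
  apply: vmin; last exact: seg_trans zvu zcv.
  have [a'vu _] := seg_shift a'vz zvu; apply: (seg_trans a'vu).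
  have [//|fuv] := seg_tri (f u) Kv.
  have : set0 v by rewrite -VW; split => //; apply: seg_sub fuv.
  by [].
have all z : seg a' b z -> z <> a' -> z <> b -> seg a' (f z) z /\ f z <> z.
  move=> /(seg_tri c) [a'cz|cbz] za' zb; first exact: lower.
  exact: upper.
exists a', b; split => //.
  move=> a'b; rewrite a'b seg_refl in a'bc; exact: cb.
move=> z a'bz za' zb fzbz; have [a'fz fz] := all z a'bz za' zb.
have [V' [V [W [[nV' cV' cW V'sub VW] [Vz Wz]]]]] := not_fixed_nbhs fz.
have [u [V'u zbu uz]] := seg_near zb nV'.
have [Vu Wu] := V'sub u V'u.
have nu e : f e = e -> u <> e.
  move=> fe ue; have : set0 u by rewrite -VW; split => //; rewrite ue -fe -ue.
  by [].
have [a'bu a'uz] := seg_shift a'bz zbu.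
have [a'fu _] := all u a'bu (nu _ fa') (nu _ fb).
(* If [z] is between [f z] and [b], a point [u] just beyond [z] lies both on the segment from [z] to
   [b] and on that from [z] to [f z], which meet only in [z]. *)
apply: uz; have [a'fzu|fzfu] := seg_tri (f z) a'fu.
  apply: (seg_inter fzbz) zbu; rewrite segC; exact: seg_right a'fzu a'uz.
have : set0 u by rewrite -VW; split => //; apply: seg_sub fzfu.
by [].
Qed.

(** * A continuous limit excludes repelling pairs *)

Section RepellingPair.
Variable g : T -> T.
Hypothesis cg : continuous g.
Hypothesis Lg : forall (S : set T) x, closed S ->
  (exists N, forall n, (N <= n)%N -> S (iter n f x)) -> S (g x).
Variables a b : T.
Hypothesis rab : repelling_pair a b.

Let fa : f a = a. Proof. by case: rab. Qed.
Let fb : f b = b. Proof. by case: rab. Qed.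

(* [f] stretches [seg a x] over [x], so the points with an orbit eventually in [S]
   accumulate at [a], and continuity of [g] puts [g a = a] into [S]. *)
Lemma repelling_absorb S p : closed S -> seg a b p -> p <> a -> p <> b ->
  (exists N, forall n, (N <= n)%N -> S (iter n f p)) -> S a.
Proof.
move=> clS abp pa pb Sp; have [_ _ ab rep] := rab.
pose D := [set x | [/\ seg a b x, x <> a, x <> b &
  exists N, forall n, (N <= n)%N -> S (iter n f x)]].
have clD : closure D `<=` seg a b by move=> x cx; apply: seg_closed; apply: closureS cx => y [].
have Dp : D p by [].
have [|m [clDm abm] mmin] := @seg_min a b _ (@closed_closure _ D).
  by exists p; split => //; exact: subset_closure.
have [ma|ma] := pselect (m = a).
  have ga : [set a] (g a).
    by apply: Lg; [exact: closed_point|exists 0%N => n _; exact: iter_fix].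
  have {}ga : g a = a by [].
  rewrite -ga -ma; have : closed (g @^-1` S) by apply: closed_comp => // x _; exact: cg.
  by apply; apply: closureS clDm => x [_ _ _]; exact: Lg.
exfalso; have mp := mmin p (subset_closure Dp) abp.
have mb : m <> b by move=> mb; apply: pb; rewrite mb in mp; exact: seg_antil abp mp.
have nm := rep m abm ma mb.
have afm : seg a (f m) m by have [//|/nm] := seg_tri (f m) abm.
(* A point of [D] before [f m] has a preimage before [m], again in [D], so this preimage is [m] by
   minimality. *)
have pre x : seg a (f m) x -> D x -> D m /\ f m = x.
  move=> afx [abx xa xb [N SN]].
  have [|x' amx' fx'] := @seg_image f a m cf x; first by rewrite fa.
  have Dx' : D x'.
    split; first exact: seg_trans amx' abm.
    - by move=> x'a; apply: xa; rewrite -fx' x'a.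
    - by move=> x'b; apply: mb; rewrite x'b in amx'; exact: seg_antil abm amx'.
    - by exists N.+1 => -[//|n] Nn; rewrite iterSr fx'; exact: SN.
  have {}x'm : x' = m.
    by apply: (seg_antil amx'); apply: mmin; [exact: subset_closure|case: Dx'].
  by rewrite -x'm; split.
(* The way from [m] to [f m] follows the segment up to [w], which is beyond [m]. Points of [D] near
   [m] are thus before [f m]; by [pre], first [m] is in [D], then [f m = m]. *)
have [w [mbw Hw]] := proj_point_ex (f m) (@seg_closed m b) (@seg_connected m b)
  (ex_intro _ m (@segl m b)).
have wm : w <> m by move=> wm; apply: nm; rewrite -[X in seg _ _ X]wm; apply: Hw; exact: segr.
have nmw : ~ seg m m w by rewrite seg_refl => /wm.
have [x [Dx nx]] := clDm _ (not_seg_open nmw).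
have [abx _ _ _] := Dx.
have mbx : seg m b x by apply: (seg_right abm abx); apply: mmin => //; exact: subset_closure.
have mwx : seg m w x by have [] := seg_total mbx mbw.
have mfw : seg m (f m) w by rewrite segC; apply: Hw; exact: segl.
have afx : seg a (f m) x by have [] := seg_shift afm (seg_trans mwx mfw).
have [Dm _] := pre x afx Dx.
by have [_ fm] := pre m afm Dm; apply: nm; rewrite fm; exact: segl.
Qed.

(** [U], the union of the images of [seg a p], is connected and invariant. If it contains [b], some
    point is mapped exactly to [b] and [repelling_absorb] applies to the set of [b] alone. If not,
    [U] accumulates at [b], and the lemma applies to a short segment [seg p' b] that traps the orbit
    of [p']. *)
Lemma repelling_pair_absurd : False.
Proof.
have [_ _ ab rep] := rab.
have [p [abp pa pb]] : exists p, [/\ seg a b p, p <> a & p <> b].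
  have [V [W [nV nW _ _ VW]]] := sides_separated ab.
  have [u [Vu abu ua]] := seg_near ab nV; exists u; split => // ub.
  have : set0 u by rewrite -VW; split => //; rewrite ub; exact: nbhs_singleton nW.
  by [].
pose U := \bigcup_k (iter k f @` seg a p).
have ita n : iter n f a = a by exact: iter_fix.
have itb n : iter n f b = b by exact: iter_fix.
have Ua : U a by exists 0%N => //; exists a => //; exact: segl.
have Up : U p by exists 0%N => //; exists p => //; exact: segr.
have ci k : continuous (iter k f).
  elim: k => [|k IH] x; first exact: cvg_id.
  by apply: (@continuous_comp _ _ _ (iter k f) f); [exact: IH|exact: cf].
have cU : connected U.
  apply: bigcup_connected; first by exists a => k _; exists a => //; exact: segl.
  move=> k _; apply: connected_continuous_connected => //.
  exact: continuous_subspaceT.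
have fU x : U x -> U (f x) by move=> [k _ [z apz <-]]; exists k.+1 => //; exists z.
have [[k _ [z apz zb]]|nUb] := pselect (U b).
  suff : [set b] a by move=> /ab.
  apply: (@repelling_absorb [set b] z); first exact: closed_point.
  - exact: seg_trans apz abp.
  - by move=> za; apply: ab; rewrite -zb za ita.
  - by move=> zb'; apply: pb; rewrite zb' in apz; exact: seg_antil abp apz.
  - by exists k => n kn; rewrite /= -(subnK kn) iterD zb itb.
have fM x : closure U x -> closure U (f x).
  move=> cx; have cl : closed (f @^-1` closure U).
    by apply: closed_comp; [move=> y _; exact: cf|exact: closed_closure].
  by apply: cl; apply: closureS cx => y /fU /subset_closure.
have cM : connected (closure U) by exact: connected_closure.
(* Otherwise the last point [y] of the closure on the segment is not [b]; the closure contains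
   [f y], hence points beyond [y]. *)
have Mb : closure U b.
  have [|y [My aby] ymax] := @seg_max a b _ (@closed_closure _ U).
    by exists p; split => //; exact: subset_closure.
  have [<- //|yb] := pselect (y = b); exfalso.
  have ya : y <> a.
    move=> ya; have := ymax p (subset_closure Up) abp.
    by rewrite ya seg_refl => /pa.
  have [w [ybw Hw]] := proj_point_ex (f y) (@seg_closed y b) (@seg_connected y b)
    (ex_intro _ y (@segl y b)).
  have wy : w <> y.
    by move=> wy; apply: (rep y aby ya yb); rewrite -[X in seg _ _ X]wy; apply: Hw; exact: segr.
  have Mw : closure U w.
    by apply: (seg_sub cM (fM y My) My); apply: Hw; exact: segl.
  have [abw awy] := seg_shift aby ybw.
  by apply: wy; apply: seg_antil awy; exact: ymax.
pose F := [set x : T | branching_point x] `\ b `|` [set a].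
have nF : nbhs b (~` F).
  apply: open_nbhs_nbhs; split; last by case=> [[_]|/esym]; [apply|exact: ab].
  apply: closed_openC; apply: closedU; last exact: closed_point.
  apply: compact_closed => //; apply: finite_compact; exact: finite_setD.
have [W1 [nW1 W1b W1F cW1]] := connected_nbhs nF.
have [w [W1w baw wb]] := seg_near (nesym ab) nW1.
have abw : seg a b w by rewrite segC.
have W1a : ~ W1 a by move=> /W1F; apply; right.
(* Otherwise the median of [x], [w] and [b] would be a branching point in [W1] other than [b]. *)
have final x : ~ seg b x w -> ~ seg a x b -> seg w b x.
  move=> nw nb; have [m [xwm xbm wbm]] := median_ex x w b.
  have [<- //|mx] := pselect (m = x).
  have mw : m <> w by move=> mw; apply: nw; rewrite -mw segC.
  have mb : m <> b.
    move=> mb; rewrite mb segC in xwm; have [wab|] := seg_tri a xwm; last by [].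
    by apply: wb; apply: (seg_antil abw); rewrite segC.
  exfalso; have /W1F : W1 m by exact: seg_sub wbm.
  by apply; left; split => //; exact: (@three_sides_branching m x w b).
have nbw : ~ seg b b w by rewrite seg_refl => /wb.
have nO := not_seg_open nbw.
have nO' : nbhs b (f @^-1` [set v | ~ seg b v w]) by apply: cf; rewrite fb.
have [W2 [nW2 W2b W2sub cW2]] := connected_nbhs (filterI nW1 (filterI nO nO')).
have [p' [Up' W2p']] := Mb _ nW2.
have nUseg x : U x -> ~ seg a x b by move=> Ux axb; apply: nUb; exact: seg_sub axb.
have wbp' : seg w b p' by apply: final; [case: (W2sub _ W2p') => _ []|exact: nUseg].
have p'b : p' <> b by move=> p'b; apply: nUb; rewrite -p'b.
have W2W1 x : W2 x -> W1 x by move=> /W2sub [].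
have p'a : p' <> a by move=> p'a; apply: W1a; apply: W2W1; rewrite -p'a.
have S2 : seg p' b `<=` W2 by exact: seg_sub.
suff : seg p' b a by move=> /S2 /W2W1.
apply: (@repelling_absorb (seg p' b) p') => //.
  by have [] := seg_shift abw wbp'.
exists 0%N => n _; suff : seg p' b (iter n f p') /\ U (iter n f p') by case.
elim: n => [|n [IH Un]]; first by split => //; exact: segl.
rewrite iterS; set x := iter n f p' in IH Un *.
split; last exact: fU.
have wbx : seg w b x by have [] := seg_shift wbp' IH.
have abx : seg a b x by have [] := seg_shift abw wbx.
have xb : x <> b by move=> xb; apply: nUb; rewrite -xb.
have xa : x <> a by move=> xa; apply: W1a; apply: W2W1; apply: S2; rewrite -xa.
have nx := rep x abx xa xb.
have wbfx : seg w b (f x).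
  by apply: final; [case: (W2sub _ (S2 _ IH)) => _ []|apply: nUseg; exact: fU].
have [wfx|wxf] := seg_total wbx wbfx.
  by have [] := seg_shift IH (seg_right wbx wbfx wfx).
by case: nx; exact: seg_right wbfx wbx wxf.
Qed.

End RepellingPair.

(** A non-fixed [c] between fixed points [a] and [b] is between [f c] and one of them, so it yields
    a repelling pair. *)
Lemma fixed_connected (g : T -> T) : continuous g ->
  (forall (S : set T) x, closed S ->
     (exists N, forall n, (N <= n)%N -> S (iter n f x)) -> S (g x)) ->
  connected [set x | f x = x].
Proof.
move=> cg Lg; apply: seg_convex => a b fa fb c abc.
apply: contrapT => fc; have [afc|fcb] := seg_tri (f c) abc.
  have [a' [b' rab]] := repelling_pair_ex fa fc afc.
  exact: (repelling_pair_absurd cg Lg rab).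
rewrite segC in fcb; have [a' [b' rab]] := repelling_pair_ex fb fc fcb.
exact: (repelling_pair_absurd cg Lg rab).
Qed.

End Iteration.

Lemma iter_continuous (f : T -> T) k : continuous f -> continuous (iter k f).
Proof.
move=> cf; elim: k => [|k IH] x; first exact: cvg_id.
by apply: (@continuous_comp _ _ _ (iter k f) f); [exact: IH|exact: cf].
Qed.

(** The chain of inequalities from [s] through the iterates of exponent [d], [2d], ..., [kd] returns
    to [s]. The relation is abstract so as to cover the tree order and its reverse. *)
Lemma iter_le_fixed (S : Type) (F : S -> S) (Q : S -> Prop)
    (le : S -> S -> Prop) k d s :
  (forall r, le r r) -> (forall r t u, le r t -> le t u -> le r u) ->
  (forall r t, le r t -> le t r -> r = t) ->
  (forall r, Q r -> Q (F r)) ->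
  (forall r t, Q r -> Q t -> le r t -> le (F r) (F t)) ->
  Q s -> (0 < k)%N -> iter k F s = s -> le s (iter d F s) -> iter d F s = s.
Proof.
move=> le_refl le_trans le_anti QF leF Qs k0 Fk led.
have Qi n r : Q r -> Q (iter n F r) by move=> Qr; elim: n => //= n; exact: QF.
have lei n r t : Q r -> Q t -> le r t -> le (iter n F r) (iter n F t).
  by move=> Qr Qt rt; elim: n => //= n IH; apply: leF => //; exact: Qi.
have H n : le (iter d F s) (iter (n.+1 * d) F s).
  elim: n => [|n IH]; first by rewrite mul1n.
  apply: (le_trans _ _ _ IH); rewrite [(n.+2 * d)%N]mulSn addnC iterD.
  by apply: lei => //; exact: Qi.
apply/esym/(le_anti _ _ led); have := H k.-1; rewrite prednK // mulnC iterM.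
by rewrite [iter d (iter k F) s]iter_fix.
Qed.

(** * A common period *)

Section PeriodicPoints.
Variable f : T -> T.
Hypothesis cf : continuous f.
Hypothesis fixC : forall k, (0 < k)%N -> connected [set x | iter k f x = x].

(** [y] on [seg o z] is the image under the iterate of exponent [k.-1] of some [w] on [seg o (f z)].
    Connectedness of the fixed set makes [w] fixed by the [k]-th iterate, so [w = f y]. *)
Lemma iter_seg_mono o k y z : (0 < k)%N -> f o = o ->
  iter k f y = y -> iter k f z = z -> seg o z y -> seg o (f z) (f y).
Proof.
move=> k0 fo fy fz ozy; have fio n : iter n f o = o by exact: iter_fix.
have [|w ofz fw] := @seg_image (iter k.-1 f) o (f z) (iter_continuous cf) y.
  by rewrite fio -iterSr prednK // fz.
have Fw : iter k f w = w.
  apply: (seg_sub (fixC k0) _ _ ofz) => /=; first exact: fio.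
  by rewrite -iterSr iterS fz.
by rewrite -fw -iterS prednK // Fw.
Qed.

(** Two of the first [N.+1] points of a periodic orbit are comparable, hence equal by monotonicity;
    so the period is at most [N] and divides the factorial. *)
Lemma period_bound (a : T) : exists m, (0 < m)%N /\
  forall k x, (0 < k)%N -> iter k f x = x -> iter m f x = x.
Proof.
have [q fq] := fixed_point_ex cf a.
have [N HN] := comparable_ex q.
exists (N`!)%N; split; first exact: fact_gt0.
move=> k x k0 fx; have [i [j [/andP[ij jN] cmp]]] := HN (fun i => iter i f x).
pose P y := iter k f y = y; pose d := (j - i)%N.
have fP y : P y -> P (f y) by rewrite /P -iterSr iterS => ->.
have Pi n : P (iter n f x) by elim: n => //= n; exact: fP.
have mono y z : P y -> P z -> seg q z y -> seg q (f z) (f y) by exact: iter_seg_mono.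
have jE : iter j f x = iter d f (iter i f x) by rewrite -iterD subnK // ltnW.
have dfix : iter d f (iter i f x) = iter i f x.
  case: cmp; rewrite jE => cmp.
    apply: (iter_le_fixed (le := fun y z => seg q z y) _ _ _ fP mono (Pi i) k0 (Pi i) cmp).
    - by move=> r; exact: segr.
    - by move=> r t u rt tu; exact: seg_trans rt tu.
    - by move=> r t rt tr; exact: seg_antil rt tr.
  apply: (iter_le_fixed (le := fun y z => seg q y z) _ _ _ fP _ (Pi i) k0 (Pi i) cmp).
  - by move=> r; exact: segr.
  - by move=> r t u rt tu; exact: seg_trans tu rt.
  - by move=> r t rt tr; exact: seg_antil tr rt.
  - by move=> r t Pr Pt; exact: mono.
have dx : iter d f x = x.
  (* [i * k - i] further steps complete [i] turns of the orbit. *)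
  have xE : x = iter (i * k - i) f (iter i f x).
    by rewrite -iterD subnK ?leq_pmulr // iterM iter_fix.
  by rewrite {1}xE -iterD addnC iterD dfix -xE.
have /dvdnP [e ->] : (d %| N`!)%N.
  by apply: dvdn_fact; rewrite /d subn_gt0 ij (leq_trans (leq_subr _ _)).
by rewrite iterM iter_fix.
Qed.

End PeriodicPoints.

(** * Attraction to the fixed set and stability *)

Section Attractor.
Variable h : T -> T.
Hypothesis ch : continuous h.
Let P := [set x | h x = x].
Hypothesis cP : connected P.
Hypothesis perP : forall k x, (0 < k)%N -> iter k h x = x -> P x.

Let clP : closed P. Proof. exact: fixed_closed. Qed.

(** Otherwise [flow_fixed] gives a periodic, hence fixed, point beyond [x], and [x] lies between two
    points of the connected set [P]. *)
Lemma moved_towards_fixed p x k : P p -> ~ P x -> (0 < k)%N ->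
  ~ seg p (iter k h x) x.
Proof.
move=> Pp nPx k0 /(flow_fixed (iter_continuous ch)) [d [hd pdx _]].
by apply: nPx; apply: (seg_sub cP Pp _ pdx); exact: perP hd.
Qed.

Let Y := \bigcap_n range (iter n h).

Let range_closed n : closed (range (iter n h)).
Proof.
apply: compact_closed => //; apply: continuous_compact => //.
by apply: continuous_subspaceT; exact: iter_continuous.
Qed.

Let range_decr n : range (iter n.+1 h) `<=` range (iter n h).
Proof. by move=> _ [x _ <-]; exists (h x) => //; rewrite -iterSr. Qed.

Let Y_surj y : Y y -> exists2 y', Y y' & h y' = y.
Proof.
move=> Yy; have [y' Hy'] : exists y', forall n, (range (iter n h) `&` h @^-1` [set y]) y'.
  apply: compact_nested => // [n x [/range_decr ? ?] //|n|n].
    apply: closedI => //; apply: closed_comp; last exact: closed_point.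
    by move=> x _; exact: ch.
  by have [x _ <-] := Yy n.+1 I; exists (iter n h x); split.
exists y'; last by have [] := Hy' 0%N.
by move=> n _; have [] := Hy' n.
Qed.

(** A non-fixed maximal point of [Y] has a preimage below another such point. Iterating backwards,
    two of these points are comparable, hence equal, and some point below one of them is moved up to
    it, against [moved_towards_fixed]. *)
Lemma attractor_fixed (p : T) : P p -> Y `<=` P.
Proof.
move=> Pp y0 Yy0; apply: contrapT => nPy0.
have clY : closed Y by apply: closed_bigI.
pose maxY e := Y e /\ forall d, Y d -> seg p d e -> d = e.
have maxY_ex y : Y y -> exists2 e, maxY e & seg p e y.
  move=> Yy; have [|e [Ye pey emax]] := @seg_maximal p Y y Yy; last by exists e.
  move=> A AY A0 chA; exact: chain_upper_bound.
have Pseg y e : P e -> seg p e y -> P y by move=> Pe; exact: seg_sub.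
pose E := {e | maxY e /\ ~ P e}.
have [e0 me0 pe0] := maxY_ex y0 Yy0.
have nPe0 : ~ P e0 by move=> Pe0; apply: nPy0; exact: Pseg pe0.
have /choice [next nextP] : forall e : E, exists e' : E,
    exists2 w, seg p (sval e') w & h w = sval e.
  move=> [e [[Ye maxe] nPe]] /=; have [w Yw hw] := Y_surj Ye.
  have [e' me' pe'] := maxY_ex w Yw.
  have nPe' : ~ P e' by move=> /Pseg /(_ pe') Pw; apply: nPe; rewrite -hw Pw.
  by exists (exist _ e' (conj me' nPe')), w.
pose u n := iter n next (exist _ e0 (conj me0 nPe0)).
have cover i n : exists2 w, seg p (sval (u (i + n)%N)) w & iter n h w = sval (u i).
  elim: n => [|n [w pw hw]]; first by exists (sval (u i)); [rewrite addn0; exact: segr|].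
  have [w' pw' hw'] := nextP (u (i + n)%N).
  have [|v pv hv] := @seg_image h p w' ch w; first by rewrite Pp hw'.
  exists v; last by rewrite iterSr hv.
  by rewrite addnS; exact: seg_trans pv pw'.
have [N /(_ (fun n => sval (u n))) [i [j [/andP[ij _] cmp]]]] := comparable_ex p.
have uij : sval (u j) = sval (u i).
  have [[[Yi maxi] _] [[Yj maxj] _]] := (svalP (u i), svalP (u j)).
  by case: cmp => [/(maxi _ Yj)|/(maxj _ Yi)].
have [w pw hw] := cover i (j - i)%N; rewrite subnKC ?(ltnW ij) // uij in pw.
have [_ nPi] := svalP (u i).
have nPw : ~ P w.
  move=> Pw; apply: nPi; rewrite -hw; suff -> : iter (j - i) h w = w by [].
  exact: iter_fix.
by apply: (@moved_towards_fixed p w (j - i)%N Pp nPw); rewrite ?subn_gt0 // hw.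
Qed.

Let bases := [set q | exists2 y, ~ P y & proj_point P y q].

Let same_base p y y' q q' : P p -> ~ P y -> seg p y' y ->
  proj_point P y q -> proj_point P y' q' -> q = q'.
Proof.
move=> Pp nPy py'y [Pq Hq] [Pq' Hq'].
have [pq'y|q'y'y] := seg_tri q' py'y.
  by exfalso; apply: nPy; exact: seg_sub pq'y.
have q'y'q : seg q' y' q by apply: (seg_trans _ q'y'y); rewrite segC; exact: Hq.
by apply: (@seg_antil y'); [rewrite segC|exact: Hq'].
Qed.

(** Comparable non-fixed points have the same base, so infinitely many bases would give an infinite
    antichain. *)
Lemma bases_finite (p : T) : P p -> finite_set bases.
Proof.
move=> Pp; apply: contrapT => /infiniteP /card_leP [phi].
pose q n : T := set_val (phi (exist _ n (mem_set I))).
have qinj i j : q i = q j -> i = j.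
  move=> /val_inj /(inj (f := phi)) H.
  by have [] : exist (fun n => n \in [set: nat]) i (mem_set I) =
    exist (fun n => n \in [set: nat]) j (mem_set I) by apply: H; rewrite inE.
have /choice [y yP] : forall n : nat, exists y, ~ P y /\ proj_point P y (q n).
  by move=> n; have [y ? ?] := set_valP (phi (exist _ n (mem_set I))); exists y.
have [N /(_ y) [i [j [/andP[ij _] cmp]]]] := comparable_ex p.
suff : i = j by move=> ij'; rewrite ij' ltnn in ij.
apply: qinj; have [nPi pri] := yP i; have [nPj prj] := yP j.
case: cmp => cmp; first exact: same_base Pp nPi cmp pri prj.
exact: esym (same_base Pp nPj cmp prj pri).
Qed.

(** Near [p] every non-fixed point is attached to [P] at [p]. Points attached there but outside [V]
    form a closed set [C] disjoint from [P], which late iterates cannot enter. *)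
Lemma fixed_stable (p : T) (U : set T) : P p -> nbhs p U ->
  exists2 W, nbhs p W & forall y k, W y -> U (iter k h y).
Proof.
move=> Pp nU; have YP := attractor_fixed Pp.
have clP' := clP; have P0 : P !=set0 by exists p.
have clB : closed (bases `\ p).
  apply: compact_closed => //; apply: finite_compact; apply: finite_setD.
  exact: bases_finite Pp.
have nB : nbhs p (~` (bases `\ p)).
  by apply: open_nbhs_nbhs; split; [exact: closed_openC|case=> _; apply].
have [V0 [nV0 V0p V0B cV0]] := connected_nbhs nB.
have base_p y : V0 y -> ~ P y -> proj_point P y p.
  move=> V0y nPy; have [q prq] := proj_point_ex y clP' cP P0.
  have [<- //|qp] := pselect (q = p).
  have : V0 q by apply: (seg_sub cV0 V0y V0p); case: prq => _; apply.
  by move=> /V0B; case; split => //; exists y.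
have nU0 : nbhs p (V0 `&` U) by exact: filterI.
have hp : h p = p by [].
have nhU0 : nbhs p (h @^-1` (V0 `&` U)) by apply: ch; rewrite hp.
have [V [oV Vp VU _]] := lcT (filterI nU0 nhU0).
pose C := [set y | proj_point P y p] `\` V.
have clC : closed C.
  rewrite /C setDE; apply: closedI; last exact: open_closedC.
  rewrite (_ : mkset _ = \bigcap_(r in P) [set y | seg r y p]).
    by apply: closed_bigI => r _; exact: seg_above_closed.
  apply/seteqP; split => [y [_ Hy] r Pr|y Hy]; first by rewrite /= segC; exact: Hy.
  by split => // r Pr; rewrite segC; exact: Hy.
have CP y : C y -> ~ P y.
  by move=> [[_ /(_ y) Hy] nVy] /Hy; rewrite seg_refl /= => py; apply: nVy; rewrite -py.
(* By compactness, since the ranges shrink to a set of fixed points. *)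
have [n0 Hn0] : exists n, ~ (range (iter n h) `&` C !=set0).
  apply: contrapT => /forallNP H.
  have [y Hy] : exists y, forall n, (range (iter n h) `&` C) y.
    apply: compact_nested => // [n y [/range_decr]|n|n] //; first by apply: closedI.
    by apply: contrapT => nE; exact: (H n).
  apply: (CP y); first by have [] := Hy 0%N.
  by apply: YP => n _; have [] := Hy n.
have {}Hn0 n y : (n0 <= n)%N -> ~ C (iter n h y).
  move=> n0n Cy; apply: Hn0; exists (iter n h y); split => //.
  by rewrite -(subnK n0n) addnC iterD; exists (iter (n - n0) h y).
have nW m : nbhs p [set y | forall k, (k <= m)%N -> V (iter k h y)].
  elim: m => [|m IH].
    apply: filterS (open_nbhs_nbhs (conj oV Vp)) => y Vy k.
    by rewrite leqn0 => /eqP ->.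
  have nV : nbhs p (iter m.+1 h @^-1` V).
    apply: iter_continuous => //; apply: open_nbhs_nbhs; split => //.
    by rewrite iter_fix.
  apply: filterS (filterI IH nV) => y [Hy Vy] k.
  by rewrite leq_eqVlt => /orP[/eqP -> //|]; exact: Hy.
exists [set y | forall k, (k <= n0)%N -> V (iter k h y)]; first exact: nW.
(* Up to time [n0] the orbit is in [V] by choice of [y]; afterwards each step stays in [V] or lands
   on a fixed point in [U] and stops. *)
move=> y k Wy; suff : V (iter k h y) \/ (P `&` U) (iter k h y).
  by case=> [/VU [[]] //|[]].
elim: k => [|k IH]; first by left; exact: (Wy 0%N).
have [kn0|n0k] := ltnP k n0; first by left; exact: (Wy k.+1).
rewrite iterS; case: IH => [Vk|[Pk Uk]]; last by right; rewrite Pk.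
have [_ [V0h Uh]] := VU _ Vk.
have [Ph|nPh] := pselect (P (h (iter k h y))); first by right.
left; apply: contrapT => nV; apply: (Hn0 k.+1 y); first exact: leqW.
by split => //; exact: base_p.
Qed.

(** A cluster point [p] of the orbit is fixed, and stability turns one visit near [p], shared by all
    points near [x], into locally uniform convergence. *)
Lemma iter_limit x : exists p, forall U, nbhs p U ->
  exists n A, nbhs x A /\ forall x' k, A x' -> (n <= k)%N -> U (iter k h x').
Proof.
pose tail n := closure [set iter k h x | k in [set k | (n <= k)%N]].
have [||p Hp] := @compact_nested T tail cT _ (fun n => @closed_closure _ _).
- by move=> n; apply: closureS => _ [k /= nk <-]; exists k => //; exact: ltnW.
- by move=> n; exists (iter n h x); apply: subset_closure; exists n => //=.
have Yp : Y p.
  move=> n _; apply: range_closed; apply: closureS (Hp n) => _ [k /= nk <-].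
  by rewrite -(subnK nk) addnC iterD; exists (iter (k - n) h x).
have [q hq] := fixed_point_ex ch x.
have Pp : P p by exact: (attractor_fixed hq).
exists p => U /(fixed_stable Pp) [W nW WU].
have [_ [[n _ <-] Wn]] := Hp 0%N _ (nbhs_interior nW).
exists n, (iter n h @^-1` W); split; first by apply: iter_continuous.
by move=> x' k Wx' nk; rewrite -(subnK nk) iterD; exact: WU.
Qed.

End Attractor.

(** * From one continuous element to all *)

Lemma ellis_all_continuous (f g : T -> T) (a : T) : continuous f ->
  ellis_remainder f g -> continuous g ->
  forall g', ellis_remainder f g' -> continuous g'.
Proof.
move=> cf Eg cg.
have fixC k : (0 < k)%N -> connected [set x | iter k f x = x].
  move=> k0; have [r Hr] := ellis_iter k0 Eg.
  (* Applying [r * k - r] more steps after [g] turns exponents [r + n * k] into multiples of [k], so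
     the composite is a limit for the [k]-th iterate of [f]. *)
  apply: (@fixed_connected (iter k f) (iter_continuous cf) (iter (r * k - r) f \o g)).
    move=> x; apply: (@continuous_comp _ _ _ g (iter (r * k - r) f)); first exact: cg.
    exact: iter_continuous.
  move=> S x clS [N SN]; apply: (Hr x (iter (r * k - r) f @^-1` S)).
    by apply: closed_comp => // y _; exact: iter_continuous.
  exists N => n Nn; rewrite /preimage /= -iterD addnA subnK ?leq_pmulr // -mulnDl.
  by rewrite iterM; apply: SN; rewrite (leq_trans Nn) // leq_addl.
have [m [m0 perm]] := period_bound cf fixC a.
have ch : continuous (iter m f) by exact: iter_continuous.
have perP k x : (0 < k)%N -> iter k (iter m f) x = x -> iter m f x = x.
  by move=> k0; rewrite -iterM; apply: perm; rewrite muln_gt0 k0.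
move=> g' Eg'; have [r Hr] := ellis_iter m0 Eg'.
have cr : continuous (iter r f) by exact: iter_continuous.
have reg (y : T) (O : set T) : nbhs y O -> exists2 B, nbhs y B & closure B `<=` O.
  move=> nO; have := @compact_regular T y [set: T] hT cT filterT _ nO.
  by move=> [B nB BO]; exists B.
move=> x; have [p Hp] := iter_limit ch (fixC m m0) perP x.
(* Values of [g'] near [x] are close to [iter r f p]; this gives both the value of [g'] at [x] and
   its continuity there. *)
have lim (O : set T) : nbhs (iter r f p) O -> nbhs x (g' @^-1` O).
  move=> /reg [B nB BO]; have [n [A [nA HA]]] := Hp _ (cr p B nB).
  apply: filterS nA => x' Ax'; apply: BO; apply: (Hr x' _ (@closed_closure _ B)).
  exists n => k nk; apply: subset_closure; rewrite iterD iterM; exact: HA.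
suff gx : g' x = iter r f p by move=> O nO; apply: lim; rewrite -gx.
apply: contrapT => /sides_separated [V [W [nV nW _ _ VW]]].
have : set0 (g' x).
  by rewrite -VW; split; [exact: nbhs_singleton nV|exact: nbhs_singleton (lim _ nW)].
by [].
Qed.

End Comparable.

End TreeOrder.

Theorem theorem1p7 (R : realType) (X : metricType R) (f : X -> X)
    (hX : finite_tree X) (hf : continuous f) :
  (forall g : X -> X, ellis_remainder f g -> continuous g) \/
  (forall g : X -> X, ellis_remainder f g -> ~ continuous g).
Proof.
have [dX finB finO] := hX; have [[[a _] cX _] lcX _] := dX.
have [[g [Eg cg]]|nE] := pselect (exists g, ellis_remainder f g /\ continuous g).
  left; apply: (@ellis_all_continuous X _ cX lcX _ _ _ finB finO f g a) => //.
  - exact: metric_hausdorff.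
  - exact: dendrite_seg_connected.
  - exact: dendrite_seg_closed.
  - exact: dendrite_seg_anti.
by right => g Eg cg; apply: nE; exists g.
Qed.
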